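(* For every fixed $T>0$, $$\lim_{N\to\infty}\ \sup_{\xi\in\mathcal E_N}\ \mathbb Q^N_\xi(\tau_N\le T)=0,$$ where $\tau_N$ is the first time $t>0$ at which the trace process on $\mathcal E_N$ makes a jump from some $\xi'\in\mathcal E_N$ to some configuration $\zeta\in\mathcal E_N$ ($\zeta\neq\xi'$) with $\zeta\notin\mathcal N(\xi')$.
   Context: Standing assumptions. Fix an integer $k\ge1$ and $\rho>0$. $L=L(N)$ are positive integers with $L\to\infty$ and $N/L(N)\to\rho$ as $N\to\infty$. $(d_N)$ are positive reals with $\lim_{N\to\infty}d_NN^3\log N=0$, and $\theta_N:=N^2/d_N$. Inclusion process. $\mathbb T_L:=\mathbb Z/(L\mathbb Z)$; $\Omega_N:=\{\eta\in\mathbb N_0^{\mathbb T_L}:\sum_{x}\eta_x=N\}$, where $\mathbb N_0=\{0,1,2,\dots\}$, $\mathbb N=\{1,2,\dots\}$; $\delta^z$ is the configuration with a single particle at $z$. $(\eta_N(t))_{t\ge0}$ is the continuous-time Markov chain on $\Omega_N$ with generator $$\mathcal L_Nf(\eta)=\sum_{x\in\mathbb T_L}\sum_{y\in\{x+1,x-1\}}\theta_N\,\eta_x(d_N+\eta_y)\bigl(f(\eta-\delta^x+\delta^y)-f(\eta)\bigr).$$ Condensed configurations. For $\ell\in\{1,\dots,k\}$, $\mathbf N_N^\ell:=\{\boldsymbol n\in\mathbb N^\ell:n_1+\dots+n_\ell=N\}$, and $\mathbb I_L^\ell$ is the set of $\boldsymbol x\in\mathbb T_L^\ell$ such that (i)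 $0<x_2-x_1<\dots<x_\ell-x_1<L$, where each $x_i-x_1$ is represented in $\{0,\dots,L-1\}$, and (ii) any two of the sites $x_1,\dots,x_\ell$ are either equal or at graph distance at least $2$ in $\mathbb T_L$. For $\boldsymbol x\in\mathbb I_L^\ell$, $\boldsymbol n\in\mathbf N_N^\ell$, put $\xi_{\boldsymbol n}^{\boldsymbol x}:=\sum_{i=1}^\ell n_i\delta^{x_i}$. Let $\mathcal E_N^\ell:=\{\xi_{\boldsymbol n}^{\boldsymbol x}:\boldsymbol x\in\mathbb I_L^\ell,\boldsymbol n\in\mathbf N_N^\ell\}$ and $\mathcal E_N:=\bigcup_{\ell=1}^k\mathcal E_N^\ell$. Indices of coordinates of $\boldsymbol x,\boldsymbol n$ are cyclic modulo $\ell$; $\boldsymbol e_i$ is the $i$-th unit vector. Trace process. Let $T_N(t):=\int_0^t\mathbf 1\{\eta_N(s)\in\mathcal E_N\}\,\mathrm ds$ and $S_N(t):=\sup\{s\ge0:T_N(s)\le t\}$. The trace process on $\mathcal E_N$ is $\eta_N^{\mathcal E_N}(t):=\eta_N(S_N(t))$, a continuous-time Markov chain on $\mathcal E_N$; $\mathbb Q^N_\xi$ is its law on $D([0,\infty);\mathcal E_N)$ started at $\xi\in\mathcal E_N$. Neighbors. For $\xi=\xi_{\boldsymbol n}^{\boldsymbol x}\in\mathcal E_N^\ell$, $\mathcal N(\xi)\subset\mathcal E_N$ consists of the following elements, for each $i\in\{1,\dots,\ell\}$: - if $x_{i+1}\ne x_i+2$: the configuration $\xi_{\boldsymbol n}^{\boldsymbol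 x+\boldsymbol e_i}$; - if $x_{i-1}\ne x_i-2$: the configuration $\xi_{\boldsymbol n}^{\boldsymbol x-\boldsymbol e_i}$; - if $x_{i+1}=x_i+2$: all $\zeta\in\mathcal E_N\setminus\{\xi\}$ with $\zeta_y=\xi_y$ for all $y\notin\{x_i,x_i+1,x_i+2\}$ and $(\zeta_{x_i},\zeta_{x_i+1},\zeta_{x_i+2})$ equal to $(0,n_i+n_{i+1},0)$ or to $(m,0,n_i+n_{i+1}-m)$ for some $m\in\{0,\dots,n_i+n_{i+1}\}$; - if $x_{i-1}=x_i-2$: all $\zeta\in\mathcal E_N\setminus\{\xi\}$ with $\zeta_y=\xi_y$ for all $y\notin\{x_i,x_i-1,x_i-2\}$ and $(\zeta_{x_i},\zeta_{x_i-1},\zeta_{x_i-2})$ equal to $(0,n_i+n_{i-1},0)$ or to $(m,0,n_i+n_{i-1}-m)$ for some $m\in\{0,\dots,n_i+n_{i-1}\}$. *)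

(* Defs.v *)
From mathcomp Require Import all_boot all_order all_algebra.
From mathcomp Require Import all_classical all_reals all_analysis.

Set Implicit Arguments.
Unset Strict Implicit.
Unset Printing Implicit Defensive.

Import Order.TTheory GRing.Theory Num.Theory.
Import numFieldNormedType.Exports.

Local Open Scope classical_set_scope.
Local Open Scope ring_scope.

(* The discrete torus Z/LZ is 'I_L, with x + 1 = ordS x and x - 1 = ord_pred x
   (for 'Z_L one would have 'Z_1 = Z/2Z). *)
Notation config L := {ffun 'I_L -> nat}.

Definition Omega (N L : nat) : set (config L) :=
  [set eta | (\sum_x eta x)%N = N].

(* [eta - delta^x + delta^y]; the subtraction is truncated, which is harmless
   since the jump rate vanishes when [eta x = 0]. *)
Definition move (L : nat) (eta : config L) (x y : 'I_L) : config L :=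
  [ffun z => (eta z - (z == x) + (z == y))%N].

Definition incl_generator (R : realType) (L : nat) (d theta : R)
    (f : config L -> R) (eta : config L) : R :=
  \sum_(x : 'I_L) \sum_(y in [set ordS x; ord_pred x]%SET)
    theta * (eta x)%:R * (d + (eta y)%:R) * (f (move eta x y) - f eta).

(** Continuous-time Markov chains *)

(* [exp(t A) f], as a pointwise exponential series. *)
Definition semigroup (R : realType) (S : Type) (A : (S -> R) -> S -> R)
    (t : R) (f : S -> R) (s : S) : R :=
  limn (series (fun n => t ^+ n / n`!%:R * iter n A f s)).

Definition transition (R : realType) (S : eqType) (A : (S -> R) -> S -> R)
    (t : R) (s s' : S) : R :=
  semigroup A t (fun u => (u == s')%:R) s.

(* Cadlag paths for the discrete topology on the target. *)
Definition cadlag_path (R : realType) (S : Type) (p : R -> S) : Prop :=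
  (forall t, 0 <= t -> \forall s \near t^'+, p s = p t) /\
  (forall t, 0 < t -> exists y, \forall s \near t^'-, p s = y).

(* [X] (indexed by times [t >= 0]) is, under [P], a continuous-time Markov
   chain with state space [St] and generator [A], started at [s0]: its paths
   are cadlag and its finite-dimensional distributions are those given by the
   transition probabilities [exp(t A)]. *)
Record is_ctmc (R : realType) (S : eqType) (St : set S)
    (A : (S -> R) -> S -> R) (s0 : S) (disp : measure_display)
    (Om : measurableType disp) (P : probability Om R) (X : R -> Om -> S) :
    Prop := IsCtmc {
  ctmc_measurable : forall t s, 0 <= t -> measurable [set w | X t w = s] ;
  ctmc_state : forall t w, 0 <= t -> St (X t w) ;
  ctmc_cadlag : forall w, cadlag_path (fun t => X t w) ;
  ctmc_fdd : forall (m : nat) (t : nat -> R) (s : nat -> S),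
    t 0%N = 0 -> (forall i, t i <= t i.+1) -> (forall i, St (s i)) ->
    P [set w | forall i, (i <= m)%N -> X (t i) w = s i] =
    ((s 0%N == s0)%:R *
      \prod_(i < m) transition A (t i.+1 - t i) (s i) (s i.+1))%:E
}.

(** Condensed configurations *)

(* The representative of [y - x] in {0, ..., L - 1}. *)
Definition offset (L : nat) (x y : 'I_L) : nat := ((y + L - x) %% L)%N.

Definition tdist (L : nat) (x y : 'I_L) : nat :=
  minn (offset x y) (offset y x).

(* In the first clause [o] is the first index (it exists when [0 < l]); since
   [offset (x o) (x o) = 0], it says 0 < x_2 - x_1 < ... < x_l - x_1 < L. *)
Definition site_vector (L l : nat) (x : 'I_l -> 'I_L) : Prop :=
  (forall o i j : 'I_l, nat_of_ord o = 0%N -> (i < j)%N ->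
     (offset (x o) (x i) < offset (x o) (x j))%N) /\
  (forall i j : 'I_l, x i = x j \/ (2 <= tdist (x i) (x j))%N).

Definition mass_vector (N l : nat) (n : 'I_l -> nat) : Prop :=
  (forall i, 0 < n i)%N /\ (\sum_i n i)%N = N.

Definition xi_conf (L l : nat) (x : 'I_l -> 'I_L) (n : 'I_l -> nat) :
    config L :=
  [ffun z => (\sum_(i < l | x i == z) n i)%N].

Definition El (N L l : nat) : set (config L) :=
  [set xi | exists (x : 'I_l -> 'I_L) (n : 'I_l -> nat),
    [/\ site_vector x, mass_vector N n & xi = xi_conf x n]].

Definition E (k N L : nat) : set (config L) :=
  [set xi | exists l : nat, (1 <= l <= k)%N /\ El N l xi].

(* [x + e_i] and [x - e_i] are [shift x i (@ordS L)], [shift x i (@ord_pred L)]. *)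
Definition shift (L l : nat) (x : 'I_l -> 'I_L) (i : 'I_l)
    (g : 'I_L -> 'I_L) : 'I_l -> 'I_L :=
  fun j => if j == i then g (x j) else x j.

Definition exchange (L : nat) (xi zeta : config L) (a b c : 'I_L)
    (tot : nat) : Prop :=
  (forall y, y != a -> y != b -> y != c -> zeta y = xi y) /\
  ((zeta a, zeta b, zeta c) = (0, tot, 0)%N \/
   exists m : nat, (m <= tot)%N /\
     (zeta a, zeta b, zeta c) = (m, 0, tot - m)%N).

(* The set N(xi). The vectors (x, n) representing [xi] are unique up to cyclic
   rotation, and the clauses are invariant under rotation. *)
Definition neighbors (k N L : nat) (xi : config L) : set (config L) :=
  [set zeta | E k N zeta /\
    exists (l : nat) (x : 'I_l -> 'I_L) (n : 'I_l -> nat),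
    [/\ (1 <= l <= k)%N, site_vector x, mass_vector N n, xi = xi_conf x n &
    exists i : 'I_l,
    [\/ x (ordS i) <> ordS (ordS (x i)) /\
          zeta = xi_conf (shift x i (@ordS L)) n,
        x (ord_pred i) <> ord_pred (ord_pred (x i)) /\
          zeta = xi_conf (shift x i (@ord_pred L)) n,
        [/\ x (ordS i) = ordS (ordS (x i)), zeta <> xi &
          exchange xi zeta (x i) (ordS (x i)) (ordS (ordS (x i)))
            (n i + n (ordS i))] |
        [/\ x (ord_pred i) = ord_pred (ord_pred (x i)), zeta <> xi &
          exchange xi zeta (x i) (ord_pred (x i)) (ord_pred (ord_pred (x i)))
            (n i + n (ord_pred i))]]]].

(** Trace process *)

Definition trace_clock (R : realType) (S : Type) (D : set S) (p : R -> S)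
    (t : R) : \bar R :=
  (\int[@lebesgue_measure R]_(s in `[0%R, t]) (\1_D (p s))%:E)%E.

Definition trace_time (R : realType) (S : Type) (D : set S) (p : R -> S)
    (t : R) : \bar R :=
  ereal_sup [set s%:E | s in [set s : R | 0 <= s /\
                                (trace_clock D p s <= t%:E)%E]].

(* If the path spends only a finite total time <= t in [D] (an event of
   probability zero for an irreducible chain), the trace path at time [t] is
   sent to the cemetery [c], to be chosen outside [D]. *)
Definition trace_path (R : realType) (S : Type) (D : set S) (c : S)
    (p : R -> S) (t : R) : S :=
  if trace_time D p t is u%:E then p u else c.

(* The empty configuration, which is not in [E k N] when [0 < N]. *)
Definition empty_config (L : nat) : config L := [ffun=> 0%N].

(* The law of the trace process, as a function of sets of paths. *)
Definition trace_law (R : realType) (k N L : nat) (disp : measure_display)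
    (Om : measurableType disp) (P : probability Om R)
    (X : R -> Om -> config L) (A : set (R -> config L)) : \bar R :=
  P [set w | A (trace_path (@E k N L) (empty_config L) (fun t => X t w))].

(* At time [t > 0] the path [p] jumps from some xi' in E_N to some
   zeta in E_N, zeta <> xi', which is not a neighbor of xi'. *)
Definition bad_jump (R : realType) (k N L : nat) (p : R -> config L) (t : R) :
    Prop :=
  0 < t /\ exists xi' : config L,
    [/\ E k N xi', \forall s \near t^'-, p s = xi', E k N (p t),
        p t <> xi' & ~ neighbors k N xi' (p t)].

Definition tau (R : realType) (k N L : nat) (p : R -> config L) : \bar R :=
  ereal_inf [set t%:E | t in [set t : R | bad_jump k N p t]].

(* Main.v *)
(* Every jump out of a condensed configuration m puts one particle on an empty
   site z, adjacent to a pile. As long as no further particle enters an empty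
   site, only the block {z - 1, z, z + 1} evolves: its central occupation is a
   symmetric nearest neighbour walk with rate theta b (n - b), where n is the
   mass of the block, and when it is absorbed at 0 or n the configuration is m
   or a neighbour of m. Jumps to empty sites have total rate at most 2 N^3, and
   the excursion started with b = 1 has mean length of order log n / (theta n);
   since it starts at rate of order N^2 n, bad excursions occur at rate
   O(d_N N^3 log N) per unit of trace time.
   Quantitatively, there is a potential f(m, y), with f(m, m) = 0 and f = 1 at
   bad re-entrance points, such that the generator applied to f(m, .) is at
   most 0 off E_N and at most eps = O(d_N N^3 log N) at m. Summing the
   drift along the skeleton chain at times h Z, and letting h -> 0, bounds the
   probability of a bad jump before trace time t by eps t, whatever the
   (possibly unbounded) real time needed. *)
Require Import Defs.
From mathcomp Require Import all_boot all_order all_algebra.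
From mathcomp Require Import all_classical all_reals all_analysis.
From mathcomp Require Import measurable_realfun.
From mathcomp Require Import zify ring lra.

Set Implicit Arguments.
Unset Strict Implicit.
Unset Printing Implicit Defensive.

Import Order.TTheory GRing.Theory Num.Theory.
Import numFieldNormedType.Exports.

Local Open Scope classical_set_scope.
Local Open Scope ring_scope.

(** * Condensed configurations and blocks *)

(** [is_ctmc] supplies finite-dimensional distributions and cadlag paths, but neither the strong
    Markov property nor martingales. The supermartingale is therefore built on finite lists of
    skeleton states, and only the regularity of the paths links these lists to the trace process.
    The potential is restarted as f(u, .) at every condensed configuration u that is reached. A good
    re-entrance gives up f(m, u) >= 0 and gets f(u, u) = 0, so nothing is lost; a bad one releases
    exactly the value 1 with which it is counted. Two limits compete in the discretisation. A bad
    jump before a given trace time may come arbitrarily late in real time, so the horizon J h must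
    tend to infinity; each step costs an error of order h^2, with a constant that may be huge in N,
    so J h^2 must tend to 0. Both are taken with N fixed. All events have to be shown measurable,
    since monotonicity of P is stated for measurable sets. For the bad event this is done by
    reducing excursions to rational times. *)

Section Torus.
Local Open Scope nat_scope.
Variable L : nat.
Implicit Types (x y z : 'I_L).

Lemma val_iter_ordS j x : iter j (@ordS L) x = (x + j) %% L :> nat.
Proof.
elim: j => [|j IH] /=; first by rewrite addn0 modn_small.
by rewrite IH -addn1 modnDml addn1 addnS.
Qed.

Lemma offset_iter j x : j < L -> offset x (iter j (@ordS L) x) = j.
Proof.
move=> jL; rewrite /offset val_iter_ordS.
have xL := ltn_ord x.
have -> : (x + j) %% L + L - x = (x + j) %% L + (L - x) by lia.
by rewrite modnDml (_ : x + j + (L - x) = j + L) ?modnDr ?modn_small; lia.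
Qed.

Lemma iter_offset x y : iter (offset x y) (@ordS L) x = y.
Proof.
apply: val_inj => /=; rewrite val_iter_ordS /offset modnDmr.
have xL := ltn_ord x; have yL := ltn_ord y.
by rewrite (_ : x + (y + L - x) = y + L) ?modnDr ?modn_small; lia.
Qed.

Lemma offset_lt x y : offset x y < L.
Proof. by rewrite /offset ltn_mod; case: (L) x => // -[]. Qed.

Lemma iter_ordS_eq i j x : i < L -> j < L ->
  (iter i (@ordS L) x == iter j (@ordS L) x) = (i == j).
Proof.
move=> iL jL; apply/eqP/eqP => [e|->//].
by rewrite -(offset_iter x iL) e offset_iter.
Qed.

Lemma ordS_neq x : 1 < L -> (ordS x == x) = false.
Proof. by move=> L1; rewrite (@iter_ordS_eq 1 0) //; lia. Qed.

Lemma ordSS_neq x : 2 < L -> (ordS (ordS x) == x) = false.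
Proof. by move=> L1; rewrite (@iter_ordS_eq 2 0) //; lia. Qed.

End Torus.

Section Sparse.
Local Open Scope nat_scope.
Variables (k N L : nat).
Implicit Types (y m : config L) (x z w : 'I_L).

Definition supp y := [pred x | 0 < y x].

(** Vector-free description of [E k N] (see [E_sparse] and [sparse_E]). Site vectors are unique only
    up to rotation and awkward under the dynamics, which acts on occupation numbers. *)
Definition sparse y := [/\ \sum_x y x = N, forall x, 0 < y x -> y (ordS x) = 0 &
  0 < #|supp y| <= k].

Lemma sum_xi_conf l (x : 'I_l -> 'I_L) (n : 'I_l -> nat) :
  \sum_z xi_conf x n z = \sum_i n i.
Proof.
rewrite (partition_big x predT) //=.
by apply: eq_bigr => z _; rewrite ffunE.
Qed.

Lemma xi_conf_inj l (x : 'I_l -> 'I_L) (n : 'I_l -> nat) i :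
  injective x -> xi_conf x n (x i) = n i.
Proof.
move=> xI; rewrite ffunE (bigD1 i) //= big1 ?addn0 // => j /andP[/eqP e].
by rewrite (xI _ _ e) eqxx.
Qed.

Lemma xi_conf_gt0 l (x : 'I_l -> 'I_L) (n : 'I_l -> nat) z :
  0 < xi_conf x n z -> exists i, x i = z.
Proof.
move=> yz; apply: contrapT => ne; move: yz; rewrite ffunE big1 // => i /eqP e.
by case: ne; exists i.
Qed.

Lemma site_vector_inj l (x : 'I_l -> 'I_L) : site_vector x -> injective x.
Proof.
case=> mono _ i j e.
have l0 : 0 < l by apply: leq_ltn_trans (ltn_ord i).
have [lt|gt|/val_inj//] := ltngtP i j.
- by have := mono (Ordinal l0) _ _ erefl lt; rewrite e ltnn.
- by have := mono (Ordinal l0) _ _ erefl gt; rewrite e ltnn.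
Qed.

Lemma E_sparse y : 1 < L -> E k N y -> sparse y.
Proof.
move=> L1 [l [/andP[l1 lk] [x [n [sx [n0 sn] ->]]]]].
have xI := site_vector_inj sx; split.
- by rewrite sum_xi_conf.
- move=> z /xi_conf_gt0[i <-]; apply/eqP; rewrite -leqn0 leqNgt.
  apply/negP => /xi_conf_gt0[j e].
  have [_ /(_ i j)] := sx; rewrite e /tdist (@offset_iter _ 1) // => -[e'|].
    by move: (ordS_neq (x i) L1); rewrite -e' eqxx.
  by rewrite leq_min.
- apply/andP; split.
    apply/card_gt0P; exists (x (Ordinal l1)).
    by rewrite inE xi_conf_inj.
  have e : #|codom x| = l by rewrite (card_codom xI) card_ord.
  apply: leq_trans lk; rewrite -[leqRHS]e.
  apply: subset_leq_card; apply/fintype.subsetP => z.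
  by rewrite inE => /xi_conf_gt0[i <-]; apply: codom_f.
Qed.

(** Listing the piles by increasing distance from an occupied site x yields a site vector whose
    first entry is x. The choice of x fixes the rotation, so the pile of interest always gets index
    0. *)
Definition sites y x := [seq j <- iota 0 L | 0 < y (iter j (@ordS L) x)].
Definition site y x (i : 'I_(size (sites y x))) :=
  iter (nth 0 (sites y x) i) (@ordS L) x.
Arguments site : clear implicits.

Lemma nth_sites y x (i : 'I_(size (sites y x))) :
  (nth 0 (sites y x) i < L) && (0 < y (site y x i)).
Proof.
have := mem_nth 0 (ltn_ord i).
by rewrite mem_filter mem_iota /= add0n andbC.
Qed.

Lemma size_sites y x : size (sites y x) = #|supp y|.
Proof.
rewrite -(size_map (fun j => iter j (@ordS L) x)).
have U : uniq [seq iter j (@ordS L) x | j <- sites y x].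
  rewrite map_inj_in_uniq ?filter_uniq ?iota_uniq // => i j.
  rewrite !mem_filter !mem_iota /= !add0n => /andP[_ iL] /andP[_ jL] /eqP.
  by rewrite iter_ordS_eq // => /eqP.
rewrite -(card_uniqP U); apply: eq_card => z; rewrite inE /=.
apply/mapP/idP => [[j] /[swap] ->|yz]; first by rewrite mem_filter => /andP[].
exists (offset x z); last by rewrite iter_offset.
by rewrite mem_filter iter_offset yz mem_iota /= add0n offset_lt.
Qed.

Section Rep.
Variables (y : config L) (x : 'I_L).
Hypotheses (sy : sparse y) (yx : 0 < y x).
Notation l := (size (sites y x)).

Lemma sitesE : sites y x = 0 ::
  [seq j <- iota 1 L.-1 | 0 < y (iter j (@ordS L) x)].
Proof.
by rewrite /sites; case: (L) y x yx => [? []//|L' y' x' yx' /=]; rewrite yx'.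
Qed.

Lemma sites_gt0 : 0 < l. Proof. by rewrite sitesE. Qed.

Lemma site0 (o : 'I_l) : o = 0 :> nat -> site y x o = x.
Proof. by rewrite /site => ->; rewrite sitesE. Qed.

Lemma site_vector_site : site_vector (site y x).
Proof.
split.
- move=> o i j o0 ij; rewrite (site0 o0).
  have /andP[iL _] := nth_sites i; have /andP[jL _] := nth_sites j.
  rewrite !offset_iter //.
  by apply: (sorted_ltn_nth ltn_trans) => //; rewrite ?inE ?sorted_filter ?iota_ltn_sorted //;
     apply: ltn_trans.
- move=> i j; have /andP[_] := nth_sites i; have /andP[_] := nth_sites j.
  set a := site y x i; set b := site y x j => yb ya.
  have H c e : 0 < y c -> 0 < y e -> c = e \/ 2 <= offset c e.
    case: sy => _ sp _ yc ye.
    case E : (offset c e) (iter_offset c e) => [|[|r]] /= ec; [by left| |by right].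
    by move: (sp _ yc); rewrite ec => e0; rewrite e0 in ye.
  case: (H a b) => //; first by left.
  by case: (H b a) => //; [left|rewrite /tdist leq_min => -> ->; right].
Qed.

Lemma xi_conf_site : xi_conf (site y x) (fun i => y (site y x i)) = y.
Proof.
have xI := site_vector_inj site_vector_site.
apply/ffunP => z; case: (posnP (y z)) => [yz|yz].
  rewrite yz ffunE big1 // => i /eqP e; by rewrite e.
have zs : offset x z \in sites y x.
  by rewrite mem_filter iter_offset yz mem_iota /= add0n offset_lt.
have il : index (offset x z) (sites y x) < l by rewrite index_mem.
have e : site y x (Ordinal il) = z by rewrite /site nth_index // iter_offset.
by rewrite -{1}e xi_conf_inj // e.
Qed.

Lemma mass_vector_site : mass_vector N (fun i => y (site y x i)).
Proof.
split=> [i|]; first by have /andP[] := nth_sites i.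
by rewrite -(sum_xi_conf (site y x)) xi_conf_site; case: sy.
Qed.

Lemma size_sites_le : 1 <= l <= k.
Proof. by rewrite sites_gt0 size_sites; case: sy => _ _ /andP[]. Qed.

(** Provides the premise of the exchange clauses of [neighbors]. As x + 1 is empty, the list of
    distances starts with 0, 2, so the next pile is the one at x + 2. *)
Lemma site_ordS (o : 'I_l) : 2 < L -> o = 0 :> nat -> 0 < y (ordS (ordS x)) ->
  site y x (ordS o) = ordS (ordS x).
Proof.
move=> L3 o0 y2; have y1 : y (ordS x) = 0 by case: sy => _ /(_ _ yx).
have e : exists s, sites y x = 0 :: 2 :: s.
  rewrite sitesE; case: (L) y x L3 y1 y2 => [|[|[|L']]] //= y' x' _ y1 y2.
  by rewrite y1 y2 /=; eexists.
case: e => s es.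
have -> : site y x (ordS o) = iter (nth 0 (sites y x) 1) (@ordS L) x.
  by rewrite /site /= o0 es.
by rewrite es.
Qed.
End Rep.

Lemma sparse_E y : sparse y -> E k N y.
Proof.
move=> sy; have [_ _ /andP[/card_gt0P[x yx] _]] := sy.
exists (size (sites y x)); split; first exact: size_sites_le.
exists (site y x), (fun i => y (site y x i)); split.
- exact: site_vector_site.
- exact: mass_vector_site.
- by rewrite xi_conf_site.
Qed.

(** Stated with an addition on each side to keep truncated subtraction out. *)
Lemma xi_conf_shift l (x : 'I_l -> 'I_L) (n : 'I_l -> nat) i g w :
  xi_conf (Defs.shift x i g) n w + (x i == w) * n i =
  xi_conf x n w + (g (x i) == w) * n i.
Proof.
rewrite !ffunE !(big_mkcond (fun j => _ == w)) /= (bigD1 i) //= [in RHS](bigD1 i) //=.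
rewrite (eq_bigr (fun j => if x j == w then n j else 0)); last first.
  by move=> j ji; rewrite /Defs.shift (negbTE ji).
by rewrite /Defs.shift eqxx; do 2![case: eqP => _]; rewrite ?mul0n ?mul1n; lia.
Qed.

(* [y] arises from [m] by redistributing particles among [z - 1, z, z + 1],
   where [z] is empty in [m]; a neighbour of [z] empty in [m] stays so. *)
Definition block m z y := [/\ m z = 0,
  (forall w, w != ord_pred z -> w != z -> w != ordS z -> y w = m w),
  y (ord_pred z) + y z + y (ordS z) = m (ord_pred z) + m (ordS z),
  (m (ord_pred z) = 0 -> y (ord_pred z) = 0) &
  (m (ordS z) = 0 -> y (ordS z) = 0)].

Hypothesis L5 : 5 <= L.

Let L2 : 1 < L. Proof. exact: leq_trans L5. Qed.

(** Cases on which of z - 1 and z + 1 carry a pile of m. With none, nothing can move; with one,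
    sparsity of y forces the pile to stay or to move to z as a whole; with two, y is an exchange.
    The representation of m is based at a pile of the block. *)
Lemma block_neighbors m z y : sparse m -> sparse y -> block m z y ->
  y = m \/ neighbors k N m y.
Proof.
move=> sm sy [mz off tot bp bs].
have [_ spm _] := sm; have [_ spy _] := sy.
have Sx : ordS (ord_pred z) = z by exact: ord_predK.
move: (ord_pred z) Sx off tot bp => x Sx off tot bp.
have Pz : ord_pred z = x by rewrite -Sx ordSK.
have zS : (ordS z == z) = false by rewrite ordS_neq.
have zx : (z == x) = false by rewrite -Sx ordS_neq.
have zxS : (ordS z == x) = false by rewrite -Sx ordSS_neq //; lia.
have eqym : y x = m x -> y z = m z -> y (ordS z) = m (ordS z) -> y = m.
  move=> ex ez eS; apply/ffunP => w.
  case: (eqVneq w x) => [->|wx]; first exact: ex.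
  case: (eqVneq w z) => [->|wz]; first exact: ez.
  case: (eqVneq w (ordS z)) => [->|wS]; first exact: eS.
  exact: off.
have [mp|mp] := posnP (m x); have [ms|ms] := posnP (m (ordS z)).
- left.
  have yx0 := bp mp; have yS0 := bs ms.
  by apply: eqym; lia.
- have [yz|yz] := posnP (y z).
    left.
    have yx0 := bp mp.
    by apply: eqym; lia.
  right; split; first exact: sparse_E.
  exists (size (sites m (ordS z))), (site m (ordS z)), (fun i => m (site m (ordS z) i)).
  have := xi_conf_site sm ms; set X := site _ _ => rep.
  split; [exact: size_sites_le|exact: site_vector_site|exact: mass_vector_site|by []|].

  pose o : 'I__ := Ordinal (sites_gt0 ms); have Xo : X o = ordS z by exact: site0.
  have yS : y (ordS z) = 0 by apply: spy.
  exists o; apply: Or42; rewrite Xo ordSK ?Pz; split.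
    (* The move clause excludes a pile at distance 2 beyond z. Such a pile would sit at z - 1, which
       is empty in m. *)
    move=> e; have /andP[_] := nth_sites (ord_pred o); rewrite -/X e; lia.
  suff key w : y w = xi_conf (Defs.shift X o (@ord_pred L)) (fun i => m (X i)) w.
    by apply/ffunP => w; exact: key.
  have := xi_conf_shift X (fun i => m (X i)) o (@ord_pred L) w.
  rewrite rep Xo ordSK ?Pz; case: (eqVneq w z) => [->|wz].
    by rewrite mz zS; have := bp mp; lia.
  case: (eqVneq w (ordS z)) => [->|wS].
    lia.
  case: (eqVneq w x) => [->|wx].
    by have := bp mp; lia.
  by rewrite off //; lia.
- have [yz|yz] := posnP (y z).
    left.
    have yS0 := bs ms.
    by apply: eqym; lia.
  right; split; first exact: sparse_E.
  exists (size (sites m x)), (site m x), (fun i => m (site m x i)).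
  have := xi_conf_site sm mp; set X := site _ _ => rep.
  split; [exact: size_sites_le|exact: site_vector_site|exact: mass_vector_site|by []|].
  pose o : 'I__ := Ordinal (sites_gt0 mp); have Xo : X o = x by exact: site0.
  have yS : y (ordS z) = 0 by apply: spy.
  have yx : y x = 0 by case: (posnP (y x)) => // /spy; rewrite Sx; lia.
  exists o; apply: Or41; rewrite Xo Sx; split.
    move=> e; have /andP[_] := nth_sites (ordS o); rewrite -/X e; lia.
  suff key w : y w = xi_conf (Defs.shift X o (@ordS L)) (fun i => m (X i)) w.
    by apply/ffunP => w; exact: key.
  have := xi_conf_shift X (fun i => m (X i)) o (@ordS L) w.
  rewrite rep Xo Sx; case: (eqVneq w z) => [->|wz].
    by rewrite mz (eq_sym x) zx; lia.
  case: (eqVneq w x) => [->|wx].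
    lia.
  case: (eqVneq w (ordS z)) => [->|wS].
    by lia.
  by rewrite off //; lia.
have [->|ym] := eqVneq y m; [by left|right]; split; first exact: sparse_E.
exists (size (sites m x)), (site m x), (fun i => m (site m x i)).
have rep := xi_conf_site sm mp.
split; [exact: size_sites_le|exact: site_vector_site|exact: mass_vector_site|by []|].
pose o : 'I__ := Ordinal (sites_gt0 mp); have Xo : site m x o = x by exact: site0.
have XS : site m x (ordS o) = ordS z.
  by rewrite site_ordS ?Sx //; lia.
exists o; apply: Or43; rewrite XS Xo Sx; split => //; first exact/eqP.
split; first by move=> w wx wz wS; apply: off.
have [yz|yz] := posnP (y z); [right; exists (y x)|left].
  split; [lia|rewrite yz; congr (_, _, _); lia].
have yS : y (ordS z) = 0 by apply: spy.
have yx : y x = 0 by case: (posnP (y x)) => // /spy; rewrite Sx; lia.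
congr (_, _, _); lia.
Qed.

Lemma block_sum m z y : block m z y -> \sum_w y w = \sum_w m w.
Proof.
case=> mz off tot _ _.
have Sx : ordS (ord_pred z) = z by exact: ord_predK.
move: (ord_pred z) Sx off tot => x Sx off tot.
have zS : (ordS z == z) = false by rewrite ordS_neq.
have zx : (z == x) = false by rewrite -Sx ordS_neq.
have zxS : (ordS z == x) = false by rewrite -Sx ordSS_neq //; lia.
have split3 (u : config L) : \sum_w u w = u x + (u z + (u (ordS z) +
    \sum_(w | [&& w != x, w != z & w != ordS z]) u w)).
  rewrite (bigD1 x) //= (bigD1 z) ?zx //= (bigD1 (ordS z)) ?zS ?zxS //=.
  by do 3!congr (_ + _); apply: eq_bigl => w; rewrite andbA.
have tail : \sum_(w | [&& w != x, w != z & w != ordS z]) y w =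
    \sum_(w | [&& w != x, w != z & w != ordS z]) m w.
  by apply: eq_bigr => w /and3P[wx wz wS]; apply: off.
by rewrite !split3 tail mz; lia.
Qed.

(** These are the two absorbed states of the central occupation. If z is empty, the support of y is
    contained in that of m; if z holds the whole mass, z replaces at least one pile of m, so the
    number of piles does not grow. *)
Lemma block_sparse m z y : sparse m -> block m z y ->
  y z = 0 \/ y z = m (ord_pred z) + m (ordS z) -> sparse y.
Proof.
move=> sm B yz; have sumE := block_sum B; case: B => mz off tot bp bs.
case: sm => sumN spm /andP[sm0 smk].
have N0 : 0 < \sum_w y w.
  have /card_gt0P[x] := sm0; rewrite inE => mx.
  by rewrite sumE (bigD1 x) //= ltn_addr.
have suppy : 0 < #|supp y|.
  rewrite lt0n; apply/negP => /eqP /card0_eq s0; move: N0.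
  by rewrite big1 // => w _; have := s0 w; rewrite inE; case: (y w).
have Sx : ordS (ord_pred z) = z by exact: ord_predK.
move: (ord_pred z) Sx off tot bp yz => x Sx off tot bp yz.
have zS : (ordS z == z) = false by rewrite ordS_neq.
have zx : (z == x) = false by rewrite -Sx ordS_neq.
have zxS : (ordS z == x) = false by rewrite -Sx ordSS_neq //; lia.
have [yz0|yz1] := posnP (y z).
  have sub w : 0 < y w -> 0 < m w.
    case: (eqVneq w x) => [->|wx]; first by case: (posnP (m x)) => // /bp ->.
    case: (eqVneq w z) => [->|wz]; first lia.
    case: (eqVneq w (ordS z)) => [->|wS]; first by case: (posnP (m (ordS z))) => // /bs ->.
    by rewrite off.
  split; first by rewrite sumE.
    move=> w /sub /spm mSw; case: (posnP (y (ordS w))) => // /sub; lia.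
  rewrite suppy; apply: leq_trans smk; apply: subset_leq_card.
  by apply/fintype.subsetP => w; rewrite !inE => /sub.
have [yx yS] : y x = 0 /\ y (ordS z) = 0 by lia.
have sub w : 0 < y w -> w = z \/ [/\ w != x, w != z, w != ordS z & 0 < m w].
  case: (eqVneq w z) => [->|wz]; first by left.
  case: (eqVneq w x) => [->|wx]; first lia.
  case: (eqVneq w (ordS z)) => [->|wS]; first lia.
  by rewrite off //; right.
split; first by rewrite sumE.
  move=> w /sub[->//|[wx wz wS mw]].
  have := spm _ mw; case: (eqVneq (ordS w) x) => [->//|Swx].
  case: (eqVneq (ordS w) z) => [e|Swz].
    by move: wx; rewrite -(inj_eq (@ordS_inj L)) e Sx eqxx.
  case: (eqVneq (ordS w) (ordS z)) => [e|SwS]; last by rewrite off.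
  by move: wz; rewrite -(inj_eq (@ordS_inj L)) e eqxx.
rewrite suppy; apply: leq_trans smk.
(* A pile of m next to z: its disappearance pays for the new pile at z. *)
have [c [cs mc]] : exists c, (c = x \/ c = ordS z) /\ 0 < m c.
  have [mx|mx] := posnP (m x); last by exists x; split; [left|].
  by exists (ordS z); split; [right|lia].
have -> : #|supp y| = #|[set w | 0 < y w]%SET|.
  by apply: eq_card => w; rewrite !inE.
have -> : #|supp m| = #|[set w | 0 < m w]%SET|.
  by apply: eq_card => w; rewrite !inE.
rewrite [leqRHS](cardsD1 c) inE mc add1n.
apply: (@leq_trans #|z |: ([set w | 0 < m w] :\ c)%SET|).
  apply: subset_leq_card; apply/fintype.subsetP => w; rewrite !inE => /sub[->|[wx wz wS ->]].
    by rewrite eqxx.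
  by case: cs => ->; rewrite ?wx ?wS orbT.
by rewrite cardsU1; case: (_ \notin _).
Qed.

End Sparse.

(** * Block dynamics *)

Section Phi.
Variable R : realType.

Definition harm n : R := \sum_(i < n) (i.+1%:R)^-1.

Lemma harm0 : harm 0 = 0. Proof. by rewrite /harm big_ord0. Qed.
Lemma harmS n : harm n.+1 = harm n + n.+1%:R^-1.
Proof. by rewrite /harm big_ord_recr. Qed.

Lemma le_harm : {homo harm : m n / (m <= n)%N >-> m <= n}.
Proof.
apply: homo_leq => // [m n p|n]; first exact: le_trans.
by rewrite harmS lerDl invr_ge0.
Qed.

Lemma harm_ge0 n : 0 <= harm n.
Proof. by rewrite -harm0 le_harm. Qed.

(** The walk that jumps to either side at rate theta b (n - b) multiplies second differences by this
    rate, and by [phi_concave] it maps [phi n] to the constant - theta n. Without the constant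
    [harm n] the increments sum to 0 and one gets the solution vanishing at both ends. Only the
    value at 0 has to vanish, so [harm n] is kept to make every increment nonnegative. *)
Definition phi n b : R := \sum_(j < b) (harm n - harm j + harm (n.-1 - j)).

Lemma phi0 n : phi n 0 = 0. Proof. by rewrite /phi big_ord0. Qed.

Lemma phiS n b : phi n b.+1 = phi n b + (harm n - harm b + harm (n.-1 - b)).
Proof. by rewrite /phi big_ord_recr. Qed.

Lemma phi_ge0 n b : (b <= n)%N -> 0 <= phi n b.
Proof.
move=> bn; apply: sumr_ge0 => i _; rewrite addr_ge0 ?harm_ge0 // subr_ge0.
by apply: le_harm; apply: leq_trans (ltnW (ltn_ord i)) bn.
Qed.

(** This harmonic number is the source of the factor log N in the final bound. *)
Lemma phi1_le n : phi n 1 <= 2 * harm n.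
Proof.
rewrite phiS phi0 harm0 subn0 subr0 add0r.
have : harm n.-1 <= harm n by apply: le_harm; exact: leq_pred.
lra.
Qed.

Lemma phi_concave n b : (0 < b < n)%N ->
  phi n b.+1 + phi n b.-1 - 2 * phi n b = - (b%:R^-1 + (n - b)%:R^-1).
Proof.
case: b => // b /andP[_ bn]; rewrite /= !phiS harmS.
have -> : (n.-1 - b)%N = (n - b.+1).-1.+1 by lia.
rewrite harmS; have -> : ((n - b.+1).-1.+1 = n - b.+1)%N by lia.
have -> : (n.-1 - b.+1)%N = (n - b.+1).-1 by lia.
ring.
Qed.

End Phi.

Section Generator.
Variables (R : realType) (L : nat) (d theta : R).
Hypothesis L3 : (2 < L)%N.
Implicit Types (f : config L -> R) (y : config L).

(** The attractive part of the rate is symmetric in the two ends of an edge, so it acts through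
    second differences, which [phi_concave] evaluates. The part with factor theta * d only needs a
    crude bound. *)
Lemma incl_generator_edges f y : incl_generator d theta f y =
  \sum_x theta * (y x)%:R * (y (ordS x))%:R *
    (f (move y x (ordS x)) + f (move y (ordS x) x) - 2 * f y) +
  theta * d * \sum_x ((y x)%:R * (f (move y x (ordS x)) - f y) +
    (y (ordS x))%:R * (f (move y (ordS x) x) - f y)).
Proof.
pose F x w := theta * (y x)%:R * (d + (y w)%:R) * (f (move y x w) - f y).
transitivity (\sum_x (F x (ordS x) + F (ordS x) x)).
  rewrite /incl_generator.
  transitivity (\sum_x (F x (ordS x) + F x (ord_pred x))).
    apply: eq_bigr => x _; rewrite big_setU1 ?big_set1 //= !inE.
    apply/eqP => e; have := ordSS_neq (ord_pred x) L3.
    by rewrite ord_predK e eqxx.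
  (* Left jumps are indexed by the edge they cross: the jump from x + 1 to x is attached to x. *)
  rewrite !big_split /=; congr (_ + _).
  rewrite (reindex_inj (@ordS_inj L)) /=.
  by apply: eq_bigr => x _; rewrite ordSK.
rewrite mulr_sumr -big_split /=; apply: eq_bigr => x _; rewrite /F; ring.
Qed.

(** No jump gains more than 1. Multiplied by theta * d = N^2, the right-hand side becomes the rate 2
    N^3. *)
Lemma generator_drift f y : 0 <= theta * d ->
  (forall z, f z <= 1) -> 0 <= f y ->
  \sum_x ((y x)%:R * (f (move y x (ordS x)) - f y) +
    (y (ordS x))%:R * (f (move y (ordS x) x) - f y)) <= 2 * (\sum_x y x)%:R.
Proof.
move=> td f1 fy; apply: (@le_trans _ _ (\sum_x ((y x)%:R + (y (ordS x))%:R))).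
  apply: ler_sum => x _; apply: lerD; apply: ler_piMr => //.
  - by rewrite lerBlDr; apply: le_trans (f1 _) _; rewrite lerDl.
  - by rewrite lerBlDr; apply: le_trans (f1 _) _; rewrite lerDl.
rewrite big_split /= -!natr_sum.
have -> : (\sum_x y (ordS x) = \sum_x y x)%N.
  by rewrite [RHS](reindex_inj (@ordS_inj L)).
by rewrite mulr_natl mulr2n.
Qed.

End Generator.

Section Moves.
Local Open Scope nat_scope.
Variable L : nat.
Hypothesis L5 : 5 <= L.
Implicit Types (y m : config L) (z : 'I_L).

Let L2 : 1 < L. Proof. exact: leq_trans L5. Qed.

Lemma move_at y a b w : move y a b w = y w - (w == a) + (w == b).
Proof. by rewrite ffunE. Qed.

Lemma block_refl m z : m z = 0 -> block m z m.
Proof. by move=> mz; split => //; rewrite mz addn0. Qed.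

Lemma block_move_in_pred m z y : block m z y -> 0 < y (ord_pred z) ->
  block m z (move y (ord_pred z) z) /\ move y (ord_pred z) z z = (y z).+1.
Proof.
case=> mz off tot bp bs yp.
have Sx : ordS (ord_pred z) = z by exact: ord_predK.
rewrite /block; move: (ord_pred z) Sx off tot bp yp => x Sx off tot bp yp.
have zS : (ordS z == z) = false by rewrite ordS_neq.
have zx : (z == x) = false by rewrite -Sx ordS_neq.
have zxS : (ordS z == x) = false by rewrite -Sx ordSS_neq //; lia.
have xz : (x == z) = false by rewrite eq_sym.
have xzS : (x == ordS z) = false by rewrite eq_sym.
have zSz : (z == ordS z) = false by rewrite eq_sym.
rewrite !move_at ?eqxx ?zx ?xz ?zS ?zSz ?zxS ?xzS; split; last by lia.
split => //; [|lia|lia|lia].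
by move=> w wx wz wS; rewrite move_at (negbTE wx) (negbTE wz) off //; lia.
Qed.

(** The target is required to be occupied because a move to an empty site may leave the block; such
    moves belong to the part of the rate with factor d. *)
Lemma block_move_out_pred m z y : block m z y -> 0 < y (ord_pred z) -> 0 < y z ->
  block m z (move y z (ord_pred z)) /\ move y z (ord_pred z) z = (y z).-1.
Proof.
case=> mz off tot bp bs yp yz.
have Sx : ordS (ord_pred z) = z by exact: ord_predK.
rewrite /block; move: (ord_pred z) Sx off tot bp yp => x Sx off tot bp yp.
have zS : (ordS z == z) = false by rewrite ordS_neq.
have zx : (z == x) = false by rewrite -Sx ordS_neq.
have zxS : (ordS z == x) = false by rewrite -Sx ordSS_neq //; lia.
have xz : (x == z) = false by rewrite eq_sym.
have xzS : (x == ordS z) = false by rewrite eq_sym.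
have zSz : (z == ordS z) = false by rewrite eq_sym.
rewrite !move_at ?eqxx ?zx ?xz ?zS ?zSz ?zxS ?xzS; split; last by lia.
split => //; [|lia|lia|lia].
by move=> w wx wz wS; rewrite move_at (negbTE wx) (negbTE wz) off //; lia.
Qed.

Lemma block_move_in_succ m z y : block m z y -> 0 < y (ordS z) ->
  block m z (move y (ordS z) z) /\ move y (ordS z) z z = (y z).+1.
Proof.
case=> mz off tot bp bs yp.
have Sx : ordS (ord_pred z) = z by exact: ord_predK.
rewrite /block; move: (ord_pred z) Sx off tot bp => x Sx off tot bp.
have zS : (ordS z == z) = false by rewrite ordS_neq.
have zx : (z == x) = false by rewrite -Sx ordS_neq.
have zxS : (ordS z == x) = false by rewrite -Sx ordSS_neq //; lia.
have xz : (x == z) = false by rewrite eq_sym.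
have xzS : (x == ordS z) = false by rewrite eq_sym.
have zSz : (z == ordS z) = false by rewrite eq_sym.
rewrite !move_at ?eqxx ?zx ?xz ?zS ?zSz ?zxS ?xzS; split; last by lia.
split => //; [|lia|lia|lia].
by move=> w wx wz wS; rewrite move_at (negbTE wS) (negbTE wz) off //; lia.
Qed.

Lemma block_move_out_succ m z y : block m z y -> 0 < y (ordS z) -> 0 < y z ->
  block m z (move y z (ordS z)) /\ move y z (ordS z) z = (y z).-1.
Proof.
case=> mz off tot bp bs yp yz.
have Sx : ordS (ord_pred z) = z by exact: ord_predK.
rewrite /block; move: (ord_pred z) Sx off tot bp => x Sx off tot bp.
have zS : (ordS z == z) = false by rewrite ordS_neq.
have zx : (z == x) = false by rewrite -Sx ordS_neq.
have zxS : (ordS z == x) = false by rewrite -Sx ordSS_neq //; lia.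
have xz : (x == z) = false by rewrite eq_sym.
have xzS : (x == ordS z) = false by rewrite eq_sym.
have zSz : (z == ordS z) = false by rewrite eq_sym.
rewrite !move_at ?eqxx ?zx ?xz ?zS ?zSz ?zxS ?xzS; split; last by lia.
split => //; [|lia|lia|lia].
by move=> w wx wz wS; rewrite move_at (negbTE wS) (negbTE wz) off //; lia.
Qed.

(** Inside a block only the two edges at z interact, so the attractive part reduces to the walk of
    [y z]. An interaction at the outer ends of the block is ruled out by the clauses of [block] that
    keep empty neighbours of z empty, together with sparsity of m. *)
Lemma block_edge k N m z y x : sparse k N m -> block m z y ->
  x != ord_pred z -> x != z -> y x = 0 \/ y (ordS x) = 0.
Proof.
case=> _ spm _ [mz off tot bp bs].
have Sx : ordS (ord_pred z) = z by exact: ord_predK.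
move: (ord_pred z) Sx off tot bp => p Sx off tot bp xp xz.
have zS : (ordS z == z) = false by rewrite ordS_neq.
have zx : (z == p) = false by rewrite -Sx ordS_neq.
have zxS : (ordS z == p) = false by rewrite -Sx ordSS_neq //; lia.
have SSz : (ordS (ordS z) == z) = false by rewrite ordSS_neq //; lia.
have SSS : (ordS (ordS z) == p) = false.
  by rewrite -Sx (@iter_ordS_eq L 3 0) //; lia.
have [xS|xS] := eqVneq x (ordS z).
  have [|yx] := posnP (y x); [by left|right].
  rewrite off ?xS ?SSz ?SSS ?ordS_neq //.
  by apply: spm; case: (posnP (m (ordS z))) => // /bs; rewrite -xS; lia.
have Sxz : (ordS x == z) = false.
  by apply/negbTE; rewrite -Sx (inj_eq (@ordS_inj L)).
have SxS : (ordS x == ordS z) = false by apply/negbTE; rewrite (inj_eq (@ordS_inj L)).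
have := spm x; rewrite -off //.
case: (posnP (y x)) => [|yx /(_ isT) mSx]; [by left|right].
have [e|Sxp] := eqVneq (ordS x) p; first by rewrite e; apply: bp; rewrite -e.
by rewrite off ?Sxz ?SxS.
Qed.

End Moves.

(** * The potential and its drift *)

Section Potential.
Variables (R : realType) (k N L : nat) (d : R).
Hypotheses (L5 : (5 <= L)%N) (d0 : 0 < d) (N0 : (0 < N)%N).
Implicit Types (m y : config L) (x z : 'I_L).

Let L2 : (2 < L)%N. Proof. exact: leq_trans L5. Qed.

Definition mass m z := (m (ord_pred z) + m (ordS z))%N.

(* [2 N^3] times the mean exit time of the walk [b = y z] from [0 < b < mass m z],
   plus a linear function of [b] that makes positivity obvious; [2 N^3] bounds the
   rate of jumps to empty sites. *)
Definition block_pot m z y : R :=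
  2 * N%:R * d / (mass m z)%:R * phi R (mass m z) (y z).

(** One configuration may lie in several blocks, as m itself does. The minimum resolves the choice
    at no cost: after a move only an upper bound is needed, and [pot_le_block] gives it for
    whichever block is convenient. The cap 1 is the value outside all blocks. *)
Definition pot m y : R :=
  \big[Num.min/1]_(z | `[< block m z y >]) block_pot m z y.

Lemma pot_le1 m y : pot m y <= 1. Proof. exact: bigmin_le_id. Qed.

Lemma pot_le_block m z y : block m z y -> pot m y <= block_pot m z y.
Proof. by move=> B; apply: bigmin_le_cond; apply/asboolP. Qed.

Lemma potP m y : pot m y = 1 \/ exists2 z, block m z y & pot m y = block_pot m z y.
Proof.
rewrite /pot; elim/big_ind : _ => [|u v hu hv|z /asboolP B].
- by left.
- by rewrite /Num.min; case: ifP.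
- by right; exists z.
Qed.

Lemma block_le_mass m z y : block m z y -> (y z <= mass m z)%N.
Proof. by case=> _ _ + _ _; rewrite /mass => <-; lia. Qed.

Lemma block_pot_ge0 m z y : block m z y -> 0 <= block_pot m z y.
Proof.
move=> B; rewrite /block_pot mulr_ge0 ?phi_ge0 ?(block_le_mass B) //.
by rewrite !mulr_ge0 ?invr_ge0 // ltW.
Qed.

Lemma pot_ge0 m y : 0 <= pot m y.
Proof. by case: (potP m y) => [->//|[z B ->]]; exact: block_pot_ge0. Qed.

Lemma pot_refl m : sparse k N m -> pot m m = 0.
Proof.
case=> _ spm /andP[/card_gt0P[x mx] _]; apply/eqP.
have mz := spm _ mx; rewrite eq_le pot_ge0 andbT.
apply: le_trans (pot_le_block (block_refl mz)) _.
by rewrite /block_pot mz phi0 mulr0.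
Qed.

(** By [block_neighbors], such a y lies in no block of m. *)
Lemma pot_far m y : sparse k N m -> sparse k N y -> y <> m ->
  ~ neighbors k N m y -> pot m y = 1.
Proof.
move=> sm sy ym nb; case: (potP m y) => // -[z B _].
by case: (block_neighbors L5 sm sy B).
Qed.

Let theta := N%:R ^+ 2 / d : R.

Let thetad : theta * d = N%:R ^+ 2.
Proof. by rewrite /theta divfK // gt_eqF. Qed.

Let theta_ge0 : 0 <= theta.
Proof. by rewrite /theta divr_ge0 ?exprn_ge0 // ltW. Qed.

(** Where the potential is 1 it is maximal, so no jump increases it. Otherwise take the block
    realising the minimum: its centre is not absorbed because y is not sparse, and the concavity of
    [phi] yields a drift - 2 N^3 that cancels the bound of [generator_drift]. *)
Lemma generator_pot_le0 m y : sparse k N m -> (\sum_x y x = N)%N ->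
  ~ sparse k N y -> incl_generator d theta (pot m) y <= 0.
Proof.
move=> sm sy nsy; case: (potP m y) => [p1|[z B pz]].
  rewrite /incl_generator p1; apply: sumr_le0 => x _; apply: sumr_le0 => w _.
  apply: mulr_ge0_le0; last by rewrite subr_le0 pot_le1.
  apply: mulr_ge0; first exact: mulr_ge0.
  by apply: addr_ge0 => //; exact: ltW.
have yzm : (0 < y z < mass m z)%N.
  rewrite lt0n ltn_neqAle (block_le_mass B) andbT; apply/andP; split; apply/eqP => e.
    by apply: nsy; apply: (block_sparse L5 sm B); left.
  by apply: nsy; apply: (block_sparse L5 sm B); right.
rewrite incl_generator_edges // thetad.
have drift : N%:R ^+ 2 * \sum_x ((y x)%:R * (pot m (move y x (ordS x)) - pot m y) +
    (y (ordS x))%:R * (pot m (move y (ordS x) x) - pot m y)) <=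
    N%:R ^+ 2 * (2 * N%:R) :> R.
  apply: ler_wpM2l; first exact: exprn_ge0.
  rewrite -[in leRHS]sy; apply: (@generator_drift _ _ d theta) => //.
  - by rewrite thetad exprn_ge0.
  - exact: pot_le1.
  - exact: pot_ge0.
suff inside : \sum_x theta * (y x)%:R * (y (ordS x))%:R *
    (pot m (move y x (ordS x)) + pot m (move y (ordS x) x) - 2 * pot m y) <=
    - (N%:R ^+ 2 * (2 * N%:R)) by lra.
have Sx : ordS (ord_pred z) = z by exact: ord_predK.
have zx : (z != ord_pred z) by rewrite -{1}Sx ordS_neq //; lia.
rewrite (bigD1 (ord_pred z)) //= (bigD1 z) //= big1 ?addr0; last first.
  move=> x /andP[xp xz]; case: (block_edge L5 sm B xp xz) => ->.
    by rewrite mulr0 !mul0r.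
  by rewrite mulr0 mul0r.
rewrite Sx.
(* The second difference of [block_pot] at the central occupation. *)
pose c : R := 2 * N%:R * d / (mass m z)%:R *
  - ((y z)%:R^-1 + (mass m z - y z)%:R^-1).
have edge a u v : (0 < a -> block m z u /\ u z = (y z).+1)%N ->
    (0 < a -> block m z v /\ v z = (y z).-1)%N ->
    theta * a%:R * (y z)%:R * (pot m u + pot m v - 2 * pot m y) <=
    theta * a%:R * (y z)%:R * c.
  case: a => [|a]; first by rewrite mulr0 !mul0r.
  move=> /(_ isT)[Bu uz] /(_ isT)[Bv vz]; apply: ler_wpM2l.
    by apply: mulr_ge0 => //; exact: mulr_ge0.
  rewrite /c -phi_concave // pz mulrBr mulrDr -vz -uz.
  rewrite (mulrCA _ 2) lerB // lerD //; exact: pot_le_block.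
have e1 := @edge (y (ord_pred z)) (move y (ord_pred z) z) (move y z (ord_pred z))
  (fun h => block_move_in_pred L5 B h)
  (fun h => block_move_out_pred L5 B h (andP yzm).1).
have e2 := @edge (y (ordS z)) (move y (ordS z) z) (move y z (ordS z))
  (fun h => block_move_in_succ L5 B h)
  (fun h => block_move_out_succ L5 B h (andP yzm).1).
have -> : theta * (y z)%:R * (y (ordS z))%:R *
   (pot m (move y z (ordS z)) + pot m (move y (ordS z) z) - 2 * pot m y) =
   theta * (y (ordS z))%:R * (y z)%:R *
   (pot m (move y (ordS z) z) + pot m (move y z (ordS z)) - 2 * pot m y) by ring.
apply: le_trans (lerD e1 e2) _.
have tot : (y (ord_pred z) + y (ordS z) = mass m z - y z)%N.
  by case: B => _ _ tot _ _; rewrite /mass -tot; lia.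
have -> : theta * (y (ord_pred z))%:R * (y z)%:R * c +
  theta * (y (ordS z))%:R * (y z)%:R * c =
  theta * (y (ord_pred z) + y (ordS z))%:R * (y z)%:R * c by rewrite natrD; ring.
(* With b = [y z] and n = [mass m z], the product theta b (n - b) (2 N d / n) (1/b + 1/(n - b)) is
   exactly 2 N theta d = 2 N^3: the factor in [block_pot] was chosen for this. *)
rewrite tot le_eqVlt; apply/orP; left; apply/eqP; rewrite /c /theta.
have [yz0 yzm'] := andP yzm; have mE : mass m z = (y z + (mass m z - y z))%N by lia.
have a0 : (y z)%:R != 0 :> R by rewrite pnatr_eq0; lia.
have b0 : (mass m z - y z)%:R != 0 :> R by rewrite pnatr_eq0; lia.
have ab0 : (y z)%:R + (mass m z - y z)%:R != 0 :> R.
  by rewrite -natrD pnatr_eq0; lia.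
have dn0 : d != 0 by rewrite gt_eqF.
rewrite {2}mE natrD; field.
by rewrite dn0 a0 b0 ab0.
Qed.

(** At a sparse m no edge interacts, so only jumps of a pile onto an empty neighbour count. The pile
    size in the jump rate is at most the block mass in the denominator of [block_pot], so each exit
    contributes at most 4 N d [harm N] whatever the masses. There are at most 2 k exits, and theta *
    d = N^2. *)
Lemma generator_pot_refl m : sparse k N m ->
  incl_generator d theta (pot m) m <= 8 * k%:R * N%:R ^+ 3 * d * harm R N.
Proof.
move=> sm; have [sumN spm /andP[_ smk]] := sm.
rewrite incl_generator_edges // thetad big1 ?add0r; last first.
  move=> x _; have [->|mx] := posnP (m x); first by rewrite mulr0 !mul0r.
  by rewrite (spm _ mx) mulr0 mul0r.
have jump a z u : (0 < a)%N -> (a <= mass m z)%N -> (mass m z <= N)%N ->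
    block m z u -> u z = 1%N -> a%:R * (pot m u - pot m m) <= 4 * N%:R * d * harm R N.
  move=> a0 az zN B uz; rewrite pot_refl // subr0.
  apply: (@le_trans _ _ (a%:R * block_pot m z u)).
    by apply: ler_wpM2l => //; exact: pot_le_block.
  have mz0 : 0 < (mass m z)%:R :> R by rewrite ltr0n; lia.
  rewrite /block_pot uz.
  have -> : a%:R * (2 * N%:R * d / (mass m z)%:R * phi R (mass m z) 1) =
    2 * N%:R * d * (a%:R / (mass m z)%:R * phi R (mass m z) 1) by ring.
  have -> : 4 * N%:R * d * harm R N = 2 * N%:R * d * (2 * harm R N) by ring.
  have Nd : 0 <= 2 * N%:R * d by rewrite !mulr_ge0 // ltW.
  apply: ler_wpM2l => //; apply: (@le_trans _ _ (1 * phi R (mass m z) 1)).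
    apply: ler_wpM2r; first by apply: phi_ge0; lia.
    by rewrite ler_pdivrMr // mul1r ler_nat.
  rewrite mul1r; apply: le_trans (phi1_le _ _) _.
  by rewrite ler_pM2l //; exact: le_harm.
have massN z : (mass m z <= N)%N.
  rewrite -sumN /mass (bigD1 (ord_pred z)) //= (bigD1 (ordS z)) /= ?addnA ?leq_addr //.
  by rewrite -{1}(ord_predK z) ordSS_neq.
set C := 4 * N%:R * d * harm R N in jump.
have C0 : 0 <= C by rewrite /C !mulr_ge0 ?harm_ge0 // ltW.
have right x : (m x)%:R * (pot m (move m x (ordS x)) - pot m m) <= C * (0 < m x)%:R.
  have [->|mx] := posnP (m x); first by rewrite mul0r mulr0.
  have mS := spm _ mx; have B := block_refl mS.
  have := block_move_in_pred L5 B; rewrite ordSK => /(_ mx)[B' e].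
  rewrite mulr1; apply: (jump _ (ordS x)) => //; last by rewrite e mS.
  by rewrite /mass ordSK leq_addr.
have left x : (m (ordS x))%:R * (pot m (move m (ordS x) x) - pot m m) <=
    C * (0 < m (ordS x))%:R.
  have [->|mx] := posnP (m (ordS x)); first by rewrite mul0r mulr0.
  have mS : m x = 0%N by have [//|/spm] := posnP (m x); lia.
  have [B' e] := block_move_in_succ L5 (block_refl mS) mx.
  rewrite mulr1; apply: (jump _ x) => //; last by rewrite e mS.
  by rewrite /mass leq_addl.
have cnt : (\sum_x (0 < m x)%N <= k)%N.
  by rewrite -sum1_card in smk; rewrite -big_mkcond.
apply: (@le_trans _ _ (N%:R ^+ 2 * \sum_x (C * (0 < m x)%:R + C * (0 < m (ordS x))%:R))).
  apply: ler_wpM2l; first exact: exprn_ge0.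
  by apply: ler_sum => x _; apply: lerD.
rewrite big_split /= -!mulr_sumr -!natr_sum.
have -> : (\sum_x (0 < m (ordS x)) = \sum_x (0 < m x))%N.
  by rewrite [RHS](reindex_inj (@ordS_inj L)).
have -> : 8 * k%:R * N%:R ^+ 3 * d * harm R N = N%:R ^+ 2 * (C * k%:R + C * k%:R).
  by rewrite /C; ring.
apply: ler_wpM2l; first exact: exprn_ge0.
by apply: lerD; apply: ler_wpM2l => //; rewrite ler_nat.
Qed.

End Potential.

(** * Transition probabilities at small times *)

Section Semigroup.
Variables (R : realType) (S : eqType) (A : (S -> R) -> S -> R) (e : seq S).
Variable K : R.
Hypothesis K0 : 0 <= K.
Hypothesis A_sum : forall (I : Type) (r : seq I) (c : I -> R) (f : I -> S -> R),
  A (fun u => \sum_(i <- r) c i * f i u) = (fun u => \sum_(i <- r) c i * A (f i) u).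
Hypothesis A_local : forall f g, {in e, f =1 g} -> {in e, A f =1 A g}.
Hypothesis A_bound : forall f B, 0 <= B -> {in e, forall u, `|f u| <= B} ->
  {in e, forall u, `|A f u| <= K * B}.
Hypothesis A1 : A (fun=> 1) = fun=> 0.

Lemma iter_A_sum (I : Type) (r : seq I) (c : I -> R) (f : I -> S -> R) n :
  iter n A (fun u => \sum_(i <- r) c i * f i u) =
  (fun u => \sum_(i <- r) c i * iter n A (f i) u).
Proof. by elim: n => //= n ->; rewrite A_sum. Qed.

Lemma iter_A_local f g n : {in e, f =1 g} -> {in e, iter n A f =1 iter n A g}.
Proof. by move=> fg; elim: n => //= n IH; exact: A_local. Qed.

Lemma iter_A_bound f B n : 0 <= B -> {in e, forall u, `|f u| <= B} ->
  {in e, forall u, `|iter n A f u| <= K ^+ n * B}.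
Proof.
move=> B0 fB; elim: n => [|n IH] u ue /=; first by rewrite expr0 mul1r fB.
by rewrite exprS -mulrA A_bound // mulr_ge0 // exprn_ge0.
Qed.

Lemma iter_A1 n : iter n A (fun=> 1) = fun=> (n == 0%N)%:R.
Proof.
elim: n => //= n ->; case: n => //= n.
(* The empty sum: [A] maps the zero function to itself. *)
have := @A_sum nat [::] (fun=> 1) (fun _ _ => 0).
rewrite (_ : (fun u : S => _) = fun=> 0); last by apply/funext => u; rewrite big_nil.
by move=> ->; apply/funext => u; rewrite big_nil.
Qed.

Definition semigroup_term t f s : R^nat := fun n => t ^+ n / n`!%:R * iter n A f s.

Lemma semigroup_term_le t f B s n : 0 <= t -> 0 <= B -> s \in e ->
  {in e, forall u, `|f u| <= B} ->
  `|semigroup_term t f s n| <= B * exp_coeff (K * t) n.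
Proof.
move=> t0 B0 se fB; rewrite /semigroup_term normrM ger0_norm; last first.
  by rewrite divr_ge0 // exprn_ge0.
have -> : B * exp_coeff (K * t) n = t ^+ n / n`!%:R * (K ^+ n * B).
  by rewrite /exp_coeff /= exprMn; ring.
by rewrite ler_wpM2l ?(iter_A_bound (B := B)) // divr_ge0 ?exprn_ge0.
Qed.

Lemma exp_coeff_ge0 x n : 0 <= x -> 0 <= @exp_coeff R x n.
Proof. by move=> x0; rewrite /exp_coeff /= divr_ge0 ?exprn_ge0. Qed.

Lemma is_cvg_semigroup t f B s : 0 <= t -> 0 <= B -> s \in e ->
  {in e, forall u, `|f u| <= B} -> cvgn (series (semigroup_term t f s)).
Proof.
move=> t0 B0 se fB; apply: normed_cvg.
apply: (@series_le_cvg _ _ (fun n => B * exp_coeff (K * t) n)).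
- by move=> n; exact: normr_ge0.
- by move=> n; rewrite mulr_ge0 // exp_coeff_ge0 // mulr_ge0.
- by move=> n; apply: semigroup_term_le.
- exact: is_cvg_seriesZ (is_cvg_series_exp_coeff _).
Qed.

(** The tail from order 2 on is compared termwise with the exponential series, using (i + 2)! >=
    i!. *)
Lemma semigroup_expansion t f B s : 0 <= t -> 0 <= B -> s \in e ->
  {in e, forall u, `|f u| <= B} ->
  `|semigroup A t f s - (f s + t * A f s)| <= B * (K * t) ^+ 2 * expR (K * t).
Proof.
move=> t0 B0 se fB; have cv := is_cvg_semigroup t0 B0 se fB.
set M := B * _ * _; set v := semigroup_term t f s in cv.
have Kt : 0 <= K * t by exact: mulr_ge0.
have vb n : `|series v n.+2 - (f s + t * A f s)| <= M.
  rewrite /series /= big_mkord 2!big_ord_recl /= {1 2}/v /semigroup_term /=.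
  rewrite expr0 expr1 !divr1 mul1r addrA [_ + _ - _]addrC addKr.
  apply: le_trans (ler_norm_sum _ _ _) _.
  apply: (@le_trans _ _ (\sum_(i < n) B * (K * t) ^+ 2 * exp_coeff (K * t) i)).
    apply: ler_sum => i _; apply: le_trans (semigroup_term_le _ t0 B0 se fB) _.
    rewrite -mulrA; apply: ler_wpM2l => //; rewrite /exp_coeff /= mulrA.
    rewrite -exprD /bump !leq0n !add1n add2n; apply: ler_wpM2l; first exact: exprn_ge0.
    by rewrite lef_pV2 ?posrE ?ltr0n ?fact_gt0 // ler_nat !factS mulnA leq_pmull.
  rewrite -mulr_sumr; apply: ler_wpM2l; first by rewrite mulr_ge0 ?exprn_ge0.
  rewrite -(big_mkord xpredT (fun i => exp_coeff (K * t) i)).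
  apply: (@nondecreasing_cvgn_le _ (series (exp_coeff (K * t)))).
    by apply: nondecreasing_series => i _ _; exact: exp_coeff_ge0.
  exact: is_cvg_series_exp_coeff.
rewrite ler_distl; apply/andP; split.
- apply: limr_ge => //; near=> n.
  have n2 : (2 <= n)%N by near: n; exists 2%N.
  have := vb n.-2; rewrite (_ : n.-2.+2 = n); last by lia.
  by rewrite ler_distl => /andP[].
- apply: limr_le => //; near=> n.
  have n2 : (2 <= n)%N by near: n; exists 2%N.
  have := vb n.-2; rewrite (_ : n.-2.+2 = n); last by lia.
  by rewrite ler_distl => /andP[].
Unshelve. all: by end_near. Qed.

Lemma semigroup1 t s : semigroup A t (fun=> 1) s = 1.
Proof.
rewrite /semigroup; apply: cvg_lim => //.
apply: (@cvg_trans _ ((fun=> 1 : R) @ \oo)); last exact: cvg_cst.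
apply: near_eq_cvg; near=> n.
have n1 : (1 <= n)%N by near: n; exists 1%N.
rewrite /series /= -(prednK n1) big_nat_recl // big1 /=.
  by rewrite expr0 fact0 divr1 mulr1 addr0.
by move=> i _; rewrite -iterS iter_A1 mulr0.
Unshelve. all: by end_near. Qed.

Lemma cvg_lin (I : Type) (r : seq I) (c : I -> R) (u : I -> R^nat) (l : I -> R) :
  (forall i, u i @ \oo --> l i) ->
  (fun n => \sum_(i <- r) c i * u i n) @ \oo --> \sum_(i <- r) c i * l i.
Proof.
move=> ul; elim: r => [|i r IH].
  by rewrite big_nil; under eq_fun do rewrite big_nil; exact: cvg_cst.
rewrite big_cons; under eq_fun do rewrite big_cons.
by apply: cvgD IH; apply: cvgM => //; exact: cvg_cst.
Qed.

(** On the finite list e, g is a combination of indicators, and the partial sums of the exponential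
    series are linear in g. *)
Lemma transition_sum t s g : uniq e -> 0 <= t -> s \in e ->
  \sum_(u <- e) transition A t s u * g u = semigroup A t g s.
Proof.
move=> Ue t0 se; rewrite /transition.
pose f u : S -> R := fun v => (v == u)%:R.
have fb u : {in e, forall v, `|f u v| <= 1}.
  by move=> v _; rewrite /f; case: (_ == _); rewrite ?normr1 ?normr0.
have cv u : series (semigroup_term t (f u) s) @ \oo --> semigroup A t (f u) s.
  exact: is_cvg_semigroup (fb u).
have ge : {in e, g =1 (fun v => \sum_(u <- e) g u * f u v)}.
  move=> v ve; rewrite (bigD1_seq v) //= /f eqxx mulr1 big1 ?addr0 //.
  by move=> w wv; rewrite eq_sym (negbTE wv) mulr0.
have E : series (semigroup_term t g s) =
    (fun n => \sum_(u <- e) g u * series (semigroup_term t (f u) s) n).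
  apply/funext => n; rewrite /series /=.
  under [RHS]eq_bigr do rewrite mulr_sumr.
  rewrite exchange_big /=; apply: eq_bigr => i _.
  rewrite /semigroup_term (iter_A_local _ ge) // iter_A_sum mulr_sumr.
  by apply: eq_bigr => u _; rewrite mulrCA.
under eq_bigr do rewrite mulrC.
apply/esym; apply: cvg_lim => //.
rewrite -/(semigroup_term t g s) E; exact: cvg_lin.
Qed.

End Semigroup.

(** * Skeleton chains *)

Lemma le_mu_bigcup_seq (R : realType) (disp : measure_display) (Om : measurableType disp)
    (P : probability Om R) (I : Type) (r : seq I) (Q : pred I) (F : I -> set Om) :
  (forall i, measurable (F i)) ->
  measurable (\big[setU/set0]_(i <- r | Q i) F i) /\
  (P (\big[setU/set0]_(i <- r | Q i) F i) <= \sum_(i <- r | Q i) P (F i))%E.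
Proof.
move=> mF; elim: r => [|i r [mr IH]]; first by rewrite !big_nil measure0.
rewrite !big_cons; case: ifP => // _; split; first exact: measurableU.
by apply: le_trans (measureU2 P (mF i) mr) _; exact: leeD2l.
Qed.

(* Trajectories of the skeleton chain are lists with the latest state first. *)
Section Skeleton.
Variables (R : realType) (S : eqType) (e : seq S) (s0 : S) (Q : S -> S -> R).
Variables (D : pred S) (bad : rel S) (f : S -> S -> R) (h eps kap tb : R).
Hypotheses (Ue : uniq e) (s0e : s0 \in e) (Ds0 : D s0).
Hypotheses (h0 : 0 <= h) (eps0 : 0 <= eps) (kap0 : 0 <= kap) (tb0 : 0 <= tb).
Hypothesis Q1 : forall s, s \in e -> \sum_(u <- e) Q s u = 1.
Hypothesis f_ge0 : forall m s, 0 <= f m s.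
Hypothesis f_refl : forall m, m \in e -> D m -> f m m = 0.
Hypothesis f_bad : forall m s, m \in e -> D m -> s \in e -> D s -> bad m s -> 1 <= f m s.
Hypothesis bad_irr : forall m, ~~ bad m m.
Hypothesis f_step : forall m s, m \in e -> D m -> s \in e -> (D s -> s = m) ->
  \sum_(u <- e) Q s u * f m u <= f m s + eps * h * (D s)%:R + kap.

Fixpoint paths n : seq (seq S) :=
  if n is n'.+1 then [seq u :: p | p <- paths n', u <- e] else [seq [:: s] | s <- e].

Fixpoint pr (p : seq S) : R :=
  match p with
  | [::] => 0
  | s :: p' => if p' is s' :: _ then pr p' * Q s' s else (s == s0)%:R
  end.

(** The condensed state visited last, from which the potential is measured. The default [s0] lies in
    D, so [memory_in] covers all lists, including those of weight 0. *)
Definition memory (p : seq S) := head s0 [seq s <- p | D s].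

Fixpoint badp (p : seq S) : bool :=
  if p is s :: p' then
    [&& D s, bad (memory p') s & (h * (count D p')%:R < tb)%R] || badp p'
  else false.

(** The potential, switched off once the discrete clock before the current state has reached [tb],
    by the same criterion as in [badp]. *)
Definition Z (p : seq S) : R :=
  if p is s :: p' then f (memory p) s * (h * (count D p')%:R < tb)%R%:R else 0.

(* Up to [kap] per step a supermartingale: the last term compensates the drift
   collected while the discrete clock is below [tb]. *)
Definition Psi (p : seq S) : R :=
  (badp p)%:R + Z p - eps * Num.min (h * (count D (behead p))%:R) tb.

Hypothesis pr_ge0 : forall n p, p \in paths n -> 0 <= pr p.

Lemma paths_cons n p : p \in paths n ->
  exists s p', [/\ p = s :: p', s \in e & {subset p' <= e}].
Proof.
elim: n p => [|n IH] p /=.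
  by move=> /mapP[s se ->]; exists s, [::].
move=> /allpairsP[[q u] /= [qn ue ->]]; exists u, q; split => //.
have [s [p' [-> se p'e]]] := IH _ qn.
by move=> v; rewrite inE => /predU1P[->//|/p'e].
Qed.

Lemma memory_in p : {subset p <= e} -> memory p \in e /\ D (memory p).
Proof.
rewrite /memory; elim: p => [|s p IH] pe //=.
have {}IH : head s0 [seq s <- p | D s] \in e /\ D (head s0 [seq s <- p | D s]).
  by apply: IH => v vp; apply: pe; rewrite inE vp orbT.
by case: ifP => // Ds; split => //; apply: pe; rewrite mem_head.
Qed.

Lemma sum_paths_S n (F : seq S -> R) :
  \sum_(p <- paths n.+1) pr p * F p =
  \sum_(p <- paths n) \sum_(u <- e) pr (u :: p) * F (u :: p).
Proof. by rewrite /= big_allpairs_dep. Qed.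

Lemma sum_pr n : \sum_(p <- paths n) pr p * 1 = 1.
Proof.
elim: n => [|n IH].
  rewrite /= big_map (bigD1_seq s0) //= eqxx mulr1 big1 ?addr0 //.
  by move=> u /negbTE ->; rewrite mul0r.
rewrite sum_paths_S -[RHS]IH [LHS]big_seq [RHS]big_seq; apply: eq_bigr => p /paths_cons.
move=> [s [p' [-> se p'e]]] /=; under eq_bigr do rewrite mulr1.
by rewrite -mulr_sumr (Q1 se).
Qed.

Lemma Psi_step n p : p \in paths n ->
  \sum_(u <- e) pr (u :: p) * Psi (u :: p) <= pr p * (Psi p + kap).
Proof.
move=> pn; have [s [p' [pE se p'e]]] := paths_cons pn.
have pe : {subset p <= e}.
  by move=> v; rewrite pE inE => /predU1P[->//|/p'e].
have [me Dm] := memory_in pe.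
have p0 := pr_ge0 pn.
have pu0 u : u \in e -> 0 <= pr (u :: p).
  by move=> ue; apply: (@pr_ge0 n.+1); apply/allpairsP; exists (p, u).
have prE u : pr (u :: p) = pr p * Q s u by rewrite pE.
set c := h * (count D p)%:R.
set c' := h * (count D p')%:R.
have cc' : c = c' + h * (D s)%:R by rewrite /c pE /= natrD mulrDr addrC.
have c'c : c' <= c by rewrite cc' lerDl mulr_ge0.
have PsiE u : Psi (u :: p) = (D u && bad (memory p) u && (c < tb)%R || badp p)%:R
    + f (memory (u :: p)) u * (c < tb)%R%:R - eps * Num.min c tb.
  by rewrite /Psi /= -/c andbA.
have PsiE' : Psi p = (badp p)%:R + f (memory p) s * (c' < tb)%R%:R - eps * Num.min c' tb.
  by rewrite pE.
have avg a : \sum_(u <- e) a * Q s u = a by rewrite -mulr_sumr Q1 ?mulr1.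
(* Once the clock is exhausted, no further bad jump is counted and the potential is off, so the next
   value of [Psi] does not depend on u. *)
have [ctb|ctb] := ltP c tb; last first.
  have -> : \sum_(u <- e) pr (u :: p) * Psi (u :: p) =
      pr p * ((badp p)%:R - eps * tb).
    rewrite -[RHS]avg; apply: eq_bigr => u _.
    rewrite PsiE prE ltNge ctb /= andbF /= mulr0 addr0 (min_r ctb); ring.
  apply: ler_wpM2l => //; rewrite PsiE'.
  have : eps * Num.min c' tb <= eps * tb by rewrite ler_wpM2l // ge_min lexx orbT.
  have : 0 <= f (memory p) s * (c' < tb)%R%:R by rewrite mulr_ge0.
  by move: (f _ _ * _) (eps * Num.min _ _) (eps * tb) => u v w; have := kap0; lra.
apply: (@le_trans _ _ (\sum_(u <- e) pr (u :: p) *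
    (((badp p)%:R - eps * c) * 1 + f (memory p) u))).
  rewrite big_seq [leRHS]big_seq; apply: ler_sum => u ue.
  apply: ler_wpM2l; first exact: pu0.
  rewrite PsiE ctb (min_l (ltW ctb)) andbT !mulr1.
  (* Entering D at u resets the potential to [f u u] = 0; the value [f (memory p) u] released in
     this way pays for a bad jump. *)
  have key : (D u && bad (memory p) u)%:R + f (memory (u :: p)) u <= f (memory p) u.
    rewrite /memory /= -/(memory p); case Du: (D u) => /=; last by rewrite add0r.
    rewrite f_refl // addr0; case bu: (bad _ _) => //=; exact: f_bad.
  have : ((D u && bad (memory p) u) || badp p)%:R <=
     (D u && bad (memory p) u)%:R + (badp p)%:R :> R.
    by rewrite -natrD ler_nat; case: (_ && _); case: (badp p).
  lra.
have -> : \sum_(u <- e) pr (u :: p) * (((badp p)%:R - eps * c) * 1 + f (memory p) u) =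
    pr p * ((badp p)%:R - eps * c + \sum_(u <- e) Q s u * f (memory p) u).
  rewrite -[X in X + \sum_(_ <- _) _]avg -big_split mulr_sumr.
  by apply: eq_bigr => u _; rewrite prE /=; ring.
apply: ler_wpM2l => //; rewrite PsiE'.
have st : D s -> s = memory p by rewrite pE /memory /= => ->.
have := f_step me Dm se st.
have c'tb := le_lt_trans c'c ctb.
by rewrite c'tb (min_l (ltW c'tb)) mulr1 cc'; lra.
Qed.

Lemma sum_Psi n : \sum_(p <- paths n) pr p * Psi p <= n%:R * kap.
Proof.
elim: n => [|n IH].
  rewrite /= big_map (bigD1_seq s0) //= eqxx mul1r big1 ?addr0; last first.
    by move=> u /negbTE ->; rewrite mul0r.
  rewrite /Psi /= /memory /= Ds0 /= f_refl // (negbTE (bad_irr s0)) /= mul0r mulr0.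
  by rewrite (min_l tb0) mulr0 subr0 addr0 mul0r.
rewrite sum_paths_S; apply: (@le_trans _ _ (\sum_(p <- paths n) pr p * (Psi p + kap))).
  by rewrite big_seq [leRHS]big_seq; apply: ler_sum => p; exact: Psi_step.
have -> : \sum_(p <- paths n) pr p * (Psi p + kap) =
    \sum_(p <- paths n) pr p * Psi p + kap * \sum_(p <- paths n) pr p * 1.
  by rewrite mulr_sumr -big_split /=; apply: eq_bigr => p _; ring.
rewrite sum_pr mulr1 -natr1 mulrDl mul1r; lra.
Qed.

Lemma sum_badp n : \sum_(p <- paths n | badp p) pr p <= n%:R * kap + eps * tb.
Proof.
apply: (@le_trans _ _ (\sum_(p <- paths n) pr p * (Psi p + eps * tb))).
  rewrite big_mkcond big_seq [leRHS]big_seq; apply: ler_sum => p pn.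
  have -> : (if badp p then pr p else 0) = pr p * (badp p)%:R.
    by case: ifP; rewrite ?mulr1 ?mulr0.
  apply: ler_wpM2l; first exact: pr_ge0 pn.
  have : 0 <= Z p by rewrite /Z; case: (p) => // *; rewrite mulr_ge0.
  have : eps * Num.min (h * (count D (behead p))%:R) tb <= eps * tb.
    by rewrite ler_wpM2l // ge_min lexx orbT.
  rewrite /Psi; lra.
have -> : \sum_(p <- paths n) pr p * (Psi p + eps * tb) =
    \sum_(p <- paths n) pr p * Psi p + eps * tb * \sum_(p <- paths n) pr p * 1.
  by rewrite mulr_sumr -big_split /=; apply: eq_bigr => p _; ring.
by rewrite sum_pr mulr1 lerD2r sum_Psi.
Qed.

End Skeleton.

Section Trajectory.
Variables (S : eqType) (Y : nat -> S).

Fixpoint traj n : seq S := if n is n'.+1 then Y n :: traj n' else [:: Y 0%N].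

Lemma size_traj n : size (traj n) = n.+1.
Proof. by elim: n => //= n ->. Qed.

Lemma traj_paths (e : seq S) n : (forall i, Y i \in e) -> traj n \in paths e n.
Proof.
move=> Ye; elim: n => [|n IH] /=; first by apply: map_f.
by apply/allpairsP; exists (traj n, Y n.+1); split => /=.
Qed.

Lemma memory_traj s0 (D : pred S) i n : (i <= n)%N -> D (Y i) ->
  (forall j, (i < j <= n)%N -> ~~ D (Y j)) -> memory s0 D (traj n) = Y i.
Proof.
rewrite /memory; elim: n => [|n IH].
  by rewrite leqn0 => /eqP -> /= ->.
rewrite leq_eqVlt => /predU1P[->|]; first by rewrite /= => ->.
rewrite ltnS => iN Di nD /=; rewrite (negbTE (nD n.+1 _)); last by lia.
by apply: IH => // j ij; apply: nD; lia.
Qed.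

Lemma count_traj (D : pred S) n : count D (traj n) = (\sum_(i < n.+1) D (Y i))%N.
Proof.
elim: n => [|n IH] /=; first by rewrite big_ord1 addn0.
by rewrite big_ord_recr /= -IH addnC.
Qed.

Lemma badp_traj (R : realType) s0 (D : pred S) (bad : rel S) (h tb : R) i n :
  (i < n)%N -> D (Y i.+1) -> bad (memory s0 D (traj i)) (Y i.+1) ->
  h * (\sum_(j < i.+1) D (Y j))%:R < tb -> badp s0 D bad h tb (traj n).
Proof.
elim: n => // n IH; rewrite ltnS leq_eqVlt => /predU1P[->|ltin] Dy by_ ct /=.
  by rewrite Dy by_ count_traj ct.
by rewrite IH ?orbT.
Qed.

End Trajectory.

(** * Law of the skeleton of a continuous-time chain *)

Section SkeletonLaw.
Variables (R : realType) (S : eqType) (e : seq S) (St : set S).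
Variables (A : (S -> R) -> S -> R) (s0 : S).
Variables (disp : measure_display) (Om : measurableType disp) (P : probability Om R).
Variable X : R -> Om -> S.
Hypothesis HX : is_ctmc St A s0 P X.
Hypothesis Ste : forall s, St s <-> s \in e.
Variable h : R.
Hypothesis h0 : 0 <= h.
Notation Q := (transition A h).

(** Puts the weight in chronological order, the form used by [ctmc_fdd]. *)
Lemma pr_prod s p : let r := rev (s :: p) in
  pr s0 Q (s :: p) = (nth s0 r 0 == s0)%:R *
    \prod_(i < size p) Q (nth s0 r i) (nth s0 r i.+1).
Proof.
elim: p s => [|s' p IH] s /=; first by rewrite big_ord0 mulr1.
have -> : rev [:: s, s' & p] = rcons (rev (s' :: p)) s by rewrite rev_cons.
have sz : size (rev (s' :: p)) = (size p).+1 by rewrite size_rev.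
rewrite -/(pr s0 Q (s' :: p)) IH big_ord_recr /= !nth_rcons sz /= ltnn eqxx ltnSn.
rewrite -mulrA; congr (_ * (_ * _)).
  apply: eq_bigr => i _; rewrite !nth_rcons sz ltnS (ltnW (ltn_ord i)).
  by rewrite ltnS ltn_ord.
by rewrite nth_rev //= subSS subnn.
Qed.

Definition cylinder p := [set w | forall i, (i < size p)%N -> X (i%:R * h) w = nth s0 (rev p) i].

Lemma measurable_cylinder p : measurable (cylinder p).
Proof.
have -> : cylinder p = \bigcap_(i in [set i | (i < size p)%N])
    [set w | X (i%:R * h) w = nth s0 (rev p) i].
  by apply/seteqP; split => w H i /=; exact: H.
apply: bigcap_measurableType => i _.
by apply: (ctmc_measurable HX); exact: mulr_ge0.
Qed.

Lemma prob_cylinder s p : s0 \in e -> {subset s :: p <= e} ->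
  P (cylinder (s :: p)) = (pr s0 Q (s :: p))%:E.
Proof.
move=> s0e pe; rewrite pr_prod.
have := @ctmc_fdd _ _ _ _ _ _ _ _ _ HX (size p) (fun i => i%:R * h) (nth s0 (rev (s :: p))).
rewrite mul0r => /(_ erefl) -> //.
- congr (_ * _)%:E; apply: eq_bigr => i _; congr (transition _ _ _ _).
  by rewrite -natr1; ring.
- by move=> i; rewrite ler_wpM2r // ler_nat.
- move=> i; apply/Ste; have [ilt|ige] := ltnP i (size (rev (s :: p))).
    by apply: pe; rewrite -mem_rev mem_nth.
  by rewrite nth_default.
Qed.

(** Positivity is not visible in the exponential series; it is inherited from the probability of a
    cylinder. *)
Lemma pr_paths_ge0 n p : s0 \in e -> p \in paths e n -> 0 <= pr s0 Q p.
Proof.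
move=> s0e /paths_cons[s [p' [-> se p'e]]]; rewrite -lee_fin -prob_cylinder //.
by move=> v; rewrite inE => /predU1P[->|/p'e].
Qed.

Lemma traj_cylinder w n : cylinder (traj (fun i => X (i%:R * h) w) n) w.
Proof.
elim: n => [|n IH] i /=; first by rewrite ltnS leqn0 => /eqP ->.
have sz := size_traj (fun i => X (i%:R * h) w) n.
rewrite rev_cons nth_rcons size_rev sz => ile.
have [ilt|ige] := ltnP i n.+1; first by rewrite IH ?sz.
by rewrite (_ : i = n.+1) ?eqxx //; lia.
Qed.

Variables (D : pred S) (bad : rel S) (f : S -> S -> R) (eps kap tb : R).
Hypotheses (Ue : uniq e) (s0e : s0 \in e) (Ds0 : D s0).
Hypotheses (eps0 : 0 <= eps) (kap0 : 0 <= kap) (tb0 : 0 <= tb).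
Hypothesis Q1 : forall s, s \in e -> \sum_(u <- e) Q s u = 1.
Hypothesis f_ge0 : forall m s, 0 <= f m s.
Hypothesis f_refl : forall m, m \in e -> D m -> f m m = 0.
Hypothesis f_bad : forall m s, m \in e -> D m -> s \in e -> D s -> bad m s -> 1 <= f m s.
Hypothesis bad_irr : forall m, ~~ bad m m.
Hypothesis f_step : forall m s, m \in e -> D m -> s \in e -> (D s -> s = m) ->
  \sum_(u <- e) Q s u * f m u <= f m s + eps * h * (D s)%:R + kap.

Definition skeleton_bad n : set Om :=
  \big[setU/set0]_(p <- paths e n | badp s0 D bad h tb p) cylinder p.

Lemma measurable_skeleton_bad n : measurable (skeleton_bad n).
Proof. by case: (le_mu_bigcup_seq P (paths e n) (badp s0 D bad h tb) measurable_cylinder). Qed.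

Lemma prob_skeleton_bad n : (P (skeleton_bad n) <= (n%:R * kap + eps * tb)%:E)%E.
Proof.
have [_] := le_mu_bigcup_seq P (paths e n) (badp s0 D bad h tb) measurable_cylinder.
move=> /le_trans; apply.
have -> : (\sum_(p <- paths e n | badp s0 D bad h tb p) P (cylinder p))%E =
    (\sum_(p <- paths e n | badp s0 D bad h tb p) pr s0 Q p)%:E.
  rewrite -sumEFin big_seq_cond [RHS]big_seq_cond; apply: eq_bigr => p /andP[pn _].
  have [s [p' [-> se p'e]]] := paths_cons pn; rewrite prob_cylinder //.
  by move=> v; rewrite inE => /predU1P[->|/p'e].
rewrite lee_fin; apply: (@sum_badp _ _ e s0 Q D bad f h) => //.
by move=> m p; exact: pr_paths_ge0.
Qed.

Lemma skeleton_bad_traj w n : badp s0 D bad h tb (traj (fun i => X (i%:R * h) w) n) ->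
  skeleton_bad n w.
Proof.
move=> B; rewrite /skeleton_bad (big_rem (traj (fun i => X (i%:R * h) w) n)) /=.
  by rewrite B; left; exact: traj_cylinder.
apply: traj_paths => i.
by apply/Ste; apply: (ctmc_state HX); exact: mulr_ge0.
Qed.

End SkeletonLaw.

(** * The clock of the trace process *)

Section OneSided.
Variable R : realType.
Implicit Types (t : R) (Q : R -> Prop).

Lemma near_rightP t Q : (\forall s \near t^'+, Q s) <->
  exists2 dl, 0 < dl & forall s, t < s < t + dl -> Q s.
Proof.
split=> [/nbhs_ballP[dl /= d0 H]|[dl d0 H]].
  exists dl => // s /andP[ts sd]; apply: H => //.
  by rewrite /ball /= distrC ltr_norml; apply/andP; split; lra.
near=> s; apply: H; apply/andP; split; near: s; first exact: nbhs_right_gt.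
by apply: nbhs_right_lt; rewrite ltrDl.
Unshelve. all: by end_near. Qed.

Lemma near_leftP t Q : (\forall s \near t^'-, Q s) <->
  exists2 dl, 0 < dl & forall s, t - dl < s < t -> Q s.
Proof.
split=> [/nbhs_ballP[dl /= d0 H]|[dl d0 H]].
  exists dl => // s /andP[ts sd]; apply: H => //.
  by rewrite /ball /= ltr_norml; apply/andP; split; lra.
near=> s; apply: H; apply/andP; split; near: s; last exact: nbhs_left_lt.
by apply: nbhs_left_gt; rewrite ltrBlDr ltrDl.
Unshelve. all: by end_near. Qed.

End OneSided.

Section Clock.
Variables (R : realType) (S : Type) (D : set S) (p : R -> S).
Hypothesis Hp : cadlag_path p.
Notation mu := (@lebesgue_measure R).

Lemma path_right t : 0 <= t ->
  exists2 dl, 0 < dl & forall s, t <= s < t + dl -> p s = p t.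
Proof.
move=> t0; have [/(_ _ t0)/near_rightP[dl d0 H] _] := Hp.
by exists dl => // s /andP[]; rewrite le_eqVlt => /predU1P[<-//|ts sd]; apply: H; rewrite ts.
Qed.

Lemma path_left t : 0 < t ->
  exists y, exists2 dl, 0 < dl & forall s, t - dl < s < t -> p s = y.
Proof.
by move=> t0; have [_ /(_ _ t0)[y /near_leftP H]] := Hp; exists y.
Qed.

Definition occupied := [set s : R | 0 <= s /\ D (p s)].

Definition cell (h : R) (j : nat) : set R := `[j%:R * h, j.+1%:R * h[.

(* The step-function approximation of [occupied] by right endpoints of cells. *)
Definition grid h := \bigcup_(j in [set j : nat | D (p (j.+1%:R * h))]) cell h j.

Lemma measurable_grid h : measurable (grid h).
Proof. by apply: bigcup_measurable => j _; exact: measurable_itv. Qed.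

Lemma cellP h s : 0 < h -> 0 <= s -> exists j, cell h j s.
Proof.
move=> h0 s0; exists (Num.truncn (s / h)).
have /andP[a b] := truncn_itv (divr_ge0 s0 (ltW h0)).
by rewrite /cell /= in_itv /= -ler_pdivlMr // a -ltr_pdivrMr // b.
Qed.

(** The right endpoint of the cell of s lies in ]s, s + h], where right continuity applies; a left
    endpoint could precede a jump at s. *)
Lemma grid_near s dl h : 0 <= s -> 0 < h < dl ->
  (forall r, s <= r < s + dl -> p r = p s) -> grid h s <-> occupied s.
Proof.
move=> s0 /andP[h0 hd] Hs.
have key j : cell h j s -> p (j.+1%:R * h) = p s.
  rewrite /cell /= in_itv /= -natr1 mulrDl mul1r => /andP[a b].
  by apply: Hs; apply/andP; split; lra.
split=> [[j /= Dj cj]|[_ Ds]]; first by split => //; rewrite -(key _ cj).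
by have [j cj] := cellP h0 s0; exists j => //=; rewrite key.
Qed.

Lemma grid_ge0 h s : 0 < h -> grid h s -> 0 <= s.
Proof.
move=> h0 [j _]; rewrite /cell /= in_itv /= => /andP[a _].
by apply: le_trans a; rewrite mulr_ge0 // ltW.
Qed.

Lemma grid_eventually (h : R^nat) s : (forall n, 0 < h n) -> h @ \oo --> (0 : R) ->
  0 <= s -> \forall n \near \oo, grid (h n) s <-> occupied s.
Proof.
move=> h0 hcv s0; have [dl d0 Hs] := path_right s0.
have : \forall n \near \oo, h n < dl by apply: (cvgr_lt 0).
by apply: filterS => n hn; apply: (grid_near (dl := dl)) => //; rewrite h0.
Qed.

(** By [grid_eventually], this set is a lower limit of the step sets [grid]. *)
Lemma measurable_occupied : measurable occupied.
Proof.
pose h n : R := n.+1%:R^-1.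
have h0 n : 0 < h n by rewrite /h invr_gt0.
have hcv : h @ \oo --> (0 : R) by exact: cvg_harmonic.
have -> : occupied = \bigcup_m \bigcap_(n in [set n | (m <= n)%N]) grid (h n).
  apply/seteqP; split => s.
    move=> os; have [s0 _] := os.
    have [m _ Hm] := grid_eventually h0 hcv s0.
    by exists m => // n /= mn; apply/Hm.
  move=> [m _ Hm]; have s0 : 0 <= s by exact: (grid_ge0 (h0 m) (Hm m (leqnn m))).
  have [m' _ Hm'] := grid_eventually h0 hcv s0.
  by apply/(Hm' (maxn m m') (leq_maxr _ _)); apply: Hm => /=; exact: leq_maxl.
apply: bigcup_measurable => m _; apply: bigcap_measurableType => n _.
exact: measurable_grid.
Qed.

Lemma trace_clockE t : trace_clock D p t = mu (occupied `&` `[0, t]).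
Proof.
rewrite /trace_clock -integral_indic //; last exact: measurable_occupied.
apply: eq_integral => s; rewrite inE /= in_itv /= => /andP[s0 _].
congr (_%:E); rewrite !indicE; congr (nat_of_bool _)%:R.
by apply/idP/idP; rewrite !inE /occupied //= => -[].
Qed.

Let mocc a b : measurable (occupied `&` `]a, b]).
Proof. by apply: measurableI => //; exact: measurable_occupied. Qed.

Let mocc0 b : measurable (occupied `&` `[0, b]).
Proof. by apply: measurableI => //; exact: measurable_occupied. Qed.

Lemma mu_occ_le a b : a <= b -> (mu (occupied `&` `]a, b]) <= (b - a)%:E)%E.
Proof.
move=> ab; apply: (@le_trans _ _ (mu `]a, b])).
  by apply: le_measure; rewrite ?inE; [exact: mocc|exact: measurable_itv|exact: subIsetr].
rewrite lebesgue_measure_itv /=; case: ifP => _ //.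
by rewrite lee_fin subr_ge0.
Qed.

Lemma trace_clock_fin t : trace_clock D p t \is a fin_num.
Proof.
rewrite trace_clockE ge0_fin_numE //; apply: (@le_lt_trans _ _ (mu `[0, t])).
  by apply: le_measure; rewrite ?inE; [exact: mocc0|exact: measurable_itv|exact: subIsetr].
by rewrite lebesgue_measure_itv /=; case: ifP => _; rewrite ?ltry.
Qed.

Definition clock t : R := fine (trace_clock D p t).

Lemma clockE t : trace_clock D p t = (clock t)%:E.
Proof. by rewrite /clock fineK // trace_clock_fin. Qed.

Lemma clock_add a b : 0 <= a <= b ->
  (clock b)%:E = ((clock a)%:E + mu (occupied `&` `]a, b]))%E.
Proof.
move=> /andP[a0 ab]; rewrite -!clockE !trace_clockE -measureU; [|exact: mocc0|exact: mocc|].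
  rewrite -setIUr; congr (mu (_ `&` _)); apply/seteqP; split => s /=; rewrite !in_itv /=.
    by move=> /andP[s0 sb]; case: (leP s a) => sa; [left|right]; rewrite ?s0.
  by move=> [/andP[-> sa]|/andP[as_ ->]]; [exact: le_trans sa ab|rewrite andbT (le_trans a0) // ltW].
rewrite setIACA setIid; apply/seteqP; split => s //= -[_]; rewrite !in_itv /=.
by move=> [/andP[_ sa] /andP[as_ _]]; move: (le_lt_trans sa as_); rewrite ltxx.
Qed.

Lemma clock_le a b : 0 <= a <= b -> clock a <= clock b.
Proof. by move=> ab; rewrite -lee_fin (clock_add ab) leeDl. Qed.

Lemma clock_lip a b : 0 <= a <= b -> clock b <= clock a + (b - a).
Proof.
move=> /[dup] ab /andP[_ leab].
by rewrite -lee_fin (clock_add ab) EFinD leeD2l // mu_occ_le.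
Qed.

Lemma clock_in a b : 0 <= a <= b -> (forall s, a < s < b -> D (p s)) ->
  clock b = clock a + (b - a).
Proof.
move=> /[dup] ab /andP[a0 leab] H; apply/eqP; rewrite eq_le clock_lip //=.
rewrite -lee_fin (clock_add ab) EFinD leeD2l //.
have -> : (b - a)%:E = mu `]a, b[.
  rewrite lebesgue_measure_itv /= lte_fin; case: ltP => // ba.
  by rewrite (_ : b - a = 0) //; lra.
apply: le_measure; rewrite ?inE; [exact: measurable_itv|exact: mocc|] => s /=; rewrite !in_itv /= => /andP[as_ sb].
by rewrite as_ (ltW sb); split => //; split; [lra|apply: H; rewrite as_].
Qed.

Lemma clock_out a b : 0 <= a <= b -> (forall s, a < s < b -> ~ D (p s)) ->
  clock b = clock a.
Proof.
move=> /[dup] ab /andP[a0 leab] H; apply/eqP; rewrite eq_le (clock_le ab) andbT.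
rewrite -lee_fin (clock_add ab) -[leRHS]adde0 leeD2l //.
rewrite -(lebesgue_measure_set1 b); apply: le_measure; rewrite ?inE; [exact: mocc|exact: measurable_set1|].
move=> s /= [[_ Ds]]; rewrite !in_itv /= => /andP[as_].
rewrite le_eqVlt => /predU1P[//|sb]; case: (H s) => //; rewrite as_ //.
Qed.

Lemma clock0 : clock 0 = 0.
Proof.
apply/eqP; rewrite eq_le; apply/andP; split; last first.
  by rewrite -lee_fin -clockE trace_clockE.
rewrite -lee_fin -clockE trace_clockE.
apply: (@le_trans _ _ (mu [set 0])); last by rewrite lebesgue_measure_set1.
apply: le_measure; rewrite ?inE; [exact: mocc0|exact: measurable_set1|].
by move=> s /= [_]; rewrite in_itv /= => /andP[s0 s1]; apply/eqP; rewrite eq_le s0 s1.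
Qed.

Lemma trace_timeP t u : 0 <= u -> clock u = t -> (forall s, u < s -> t < clock s) ->
  trace_time D p t = u%:E.
Proof.
move=> u0 cu H; apply/eqP; rewrite eq_le; apply/andP; split.
  apply: ge_ereal_sup => _ [s [s0 +] <-]; rewrite clockE lee_fin => cs.
  by rewrite lee_fin leNgt; apply/negP => /H; rewrite ltNge cs.
by apply: ereal_sup_ubound; exists u => //; split => //; rewrite clockE cu.
Qed.

(** The clock is 1-Lipschitz, so it takes the value t at the supremum itself. *)
Lemma trace_time_fin t u : 0 <= t -> trace_time D p t = u%:E ->
  [/\ 0 <= u, clock u = t & forall s, u < s -> t < clock s].
Proof.
move=> t0 Hu; pose A := [set s%:E | s in [set s : R | 0 <= s /\ (trace_clock D p s <= t%:E)%E]].
have u0 : 0 <= u.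
  rewrite -lee_fin -Hu; apply: ereal_sup_ubound; exists 0 => //; split => //.
  by rewrite clockE clock0.
have above s : u < s -> t < clock s.
  move=> us; rewrite ltNge; apply/negP => cs; move: (us); apply/negP; rewrite -leNgt.
  rewrite -lee_fin -Hu; apply: ereal_sup_ubound; exists s => //; split.
    exact: le_trans u0 (ltW us).
  by rewrite clockE.
split => //; apply/eqP; rewrite eq_le; apply/andP; split; apply/ler_addgt0Pr => ep ep0.
  have /ereal_sup_gt[_ [s [s0 +] <-]] : ((u - ep)%:E < trace_time D p t)%E.
    by rewrite Hu lte_fin; lra.
  rewrite clockE lee_fin lte_fin => cs us.
  have su : s <= u.
    by rewrite -lee_fin -Hu; apply: ereal_sup_ubound; exists s => //; split => //; rewrite clockE.
  have : clock u <= clock s + (u - s) by apply: clock_lip; rewrite s0.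
  lra.
have : clock (u + ep) <= clock u + (u + ep - u) by apply: clock_lip; rewrite u0 /=; lra.
have : t < clock (u + ep) by apply: above; lra.
lra.
Qed.

End Clock.

(** * Excursions and jumps of the trace process *)

Section Transit.
Variables (R : realType) (S : Type) (D : set S) (p : R -> S).
Hypothesis Hp : cadlag_path p.
Notation clock := (clock D p).

(* The excursion of [p] outside [D] that the trace process sees as a jump from
   [xi] to [zeta]; [a = b] is allowed. *)
Definition transit (xi zeta : S) (a b : R) :=
  [/\ exists2 dl, 0 < dl <= a & forall s, a - dl < s < a -> p s = xi,
      a <= b, forall s, a <= s < b -> ~ D (p s) & p b = zeta].

Lemma clock_strict v s : 0 <= v -> D (p v) -> v < s -> clock v < clock s.
Proof.
move=> v0 Dv vs; have [dl d0 Hd] := path_right Hp v0.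
pose w := Num.min s (v + dl / 2).
have vw : v < w by rewrite /w lt_min vs /=; lra.
have ws : w <= s by rewrite /w ge_min lexx.
have wd : w <= v + dl / 2 by rewrite /w ge_min lexx orbT.
have e : clock w = clock v + (w - v).
  apply: clock_in => //; first by rewrite v0 ltW.
  by move=> r /andP[vr rw]; rewrite Hd //; apply/andP; split; lra.
have : clock w <= clock s by apply: (clock_le D Hp); rewrite ws; lra.
lra.
Qed.

(** The excursion is the interval on which the clock rests at t: b is the last real time with this
    clock value, and a is the first. The path avoids D in between by [clock_strict]. *)
Lemma jump_transit c t xi zeta : ~ D c -> D xi -> D zeta -> 0 < t ->
  (\forall s \near t^'-, trace_path D c p s = xi) -> trace_path D c p t = zeta ->
  exists a b, transit xi zeta a b /\ clock b = t.
Proof.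
move=> Dc Dxi Dzeta t0 /near_leftP[dl d0 Hxi].
rewrite {1}/trace_path; case E : (trace_time D p t) => [b| |] pb; try by rewrite pb in Dc.
have [b0 cb above] := trace_time_fin Hp (ltW t0) E.
pose W := [set v | 0 <= v /\ clock v < t].
have W0 : W 0 by split => //; rewrite (clock0 D Hp).
have ubW v : W v -> v <= b.
  move=> [v0 cv]; rewrite leNgt; apply/negP => bv.
  have : clock b <= clock v by apply: (clock_le D Hp); rewrite b0 ltW.
  lra.
have supW : has_sup W by split; [exists 0|exists b => v; exact: ubW].
pose a := sup W.
have ab : a <= b by apply: ge_sup => //; exists 0.
have a0 : 0 <= a by apply: ub_le_sup => //; case: supW.
have Wa v : W v -> v <= a by move=> Wv; apply: ub_le_sup => //; case: supW.
have ca : t <= clock a.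
  rewrite leNgt; apply/negP => ca.
  pose r := a + (t - clock a) / 2.
  have : clock r <= clock a + (r - a) by apply: (clock_lip D Hp); rewrite a0 /r; lra.
  rewrite /r => cr; have : r <= a by apply: Wa; split; rewrite /r; lra.
  rewrite /r; lra.
have after v : a <= v -> t <= clock v.
  by move=> av; apply: le_trans ca _; apply: (clock_le D Hp); rewrite a0.
have apos : 0 < a.
  rewrite lt_neqAle a0 andbT; apply/eqP => a00.
  by move: ca; rewrite -a00 (clock0 D Hp); lra.
exists a, b; split => //; split => //; last first.
  move=> v /andP[av vb] Dv; have := clock_strict (le_trans a0 av) Dv vb.
  by rewrite cb; have := after _ av; lra.
have [y [dl' d0' Hy]] := path_left Hp apos.
exists (Num.min dl' a).
  by rewrite lt_min d0' apos ge_min lexx orbT.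
suff yxi : y = xi.
  move=> s /andP[sl sr]; rewrite -yxi; apply: Hy; rewrite sr andbT.
  by apply: le_lt_trans sl; rewrite lerD2l lerN2 ge_min lexx.
have [w [w0 cw] wa] := @sup_adherent _ W dl' d0' supW.
(* A trace time so close to t that the trace path equals xi there, and not below [clock w], so that
   its real time v lies in ]a - dl', a[, where the path equals y. The term t / 2 keeps s
   nonnegative. *)
pose s := Num.max (clock w) (Num.max (t - dl / 2) (t / 2)).
have s1 : clock w <= s by rewrite /s le_max lexx.
have s2 : t - dl / 2 <= s by rewrite /s !le_max lexx orbT.
have s3 : t / 2 <= s by rewrite /s !le_max lexx !orbT.
have st : s < t by rewrite /s !gt_max cw /=; apply/andP; split; lra.
have : trace_path D c p s = xi by apply: Hxi; apply/andP; split; lra.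
rewrite /trace_path; case Es : (trace_time D p s) => [v| |] pv; try by rewrite pv in Dc.
have s0 : 0 <= s by lra.
have [v0 cv above'] := trace_time_fin Hp s0 Es.
rewrite -pv -(Hy v) //; apply/andP; split.
  have : w <= v by rewrite leNgt; apply/negP => /above'; lra.
  by rewrite -/a in wa *; lra.
by rewrite ltNge; apply/negP => /after; lra.
Qed.

Lemma transit_jump c xi zeta a b : D xi -> D zeta -> transit xi zeta a b ->
  [/\ 0 < clock b, \forall s \near (clock b)^'-, trace_path D c p s = xi &
      trace_path D c p (clock b) = zeta].
Proof.
move=> Dxi Dzeta [[dl /andP[d0 da] Hxi] ab Hout pb].
have a0 : 0 < a by lra.
have cab : clock b = clock a.
  apply: (clock_out Hp) => [|s /andP[as_ sb]]; first by rewrite ab ltW.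
  by apply: Hout; rewrite ltW.
have cin v w : a - dl <= v -> v <= w -> w <= a -> clock w = clock v + (w - v).
  move=> vl vw wa; apply: (clock_in Hp); first by rewrite vw andbT; lra.
  by move=> s /andP[vs sw]; rewrite Hxi //; apply/andP; split; lra.
have ctpos : 0 < clock b.
  have e : clock a = clock (a - dl) + (a - (a - dl)) by apply: cin; lra.
  have : clock 0 <= clock (a - dl) by apply: (clock_le D Hp); rewrite lexx; lra.
  by rewrite (clock0 D Hp) cab; lra.
split => //.
  apply/near_leftP; exists dl => // s /andP[sl sr].
  (* Just before a the clock runs at unit speed, and it ends at [clock a] = [clock b]; hence its
     value at v is s. *)
  pose v := a - (clock b - s).
  have vl : a - dl < v by rewrite /v; lra.
  have va : v < a by rewrite /v; lra.
  have cv : clock v = s.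
    have e : clock a = clock v + (a - v) by apply: cin => //; lra.
    by rewrite /v in e *; lra.
  rewrite /trace_path (trace_timeP Hp (u := v)) //; [|lra|].
    by apply: Hxi; rewrite vl va.
  move=> w vw; have [wa|aw] := leP w a.
    have e : clock w = clock v + (w - v) by apply: cin => //; lra.
    lra.
  have : clock a <= clock w by apply: (clock_le D Hp); apply/andP; split; lra.
  lra.
rewrite /trace_path (trace_timeP Hp (u := b)) //; first lra.
by move=> w bw; apply: clock_strict => //; [lra|rewrite pb].
Qed.

(** A trace of [transit] on countably many times, which can be expressed by measurable events. *)
Definition rat_transit (xi zeta : S) (q r : R) :=
  [/\ 0 <= q < r, p q = xi, p r = zeta &
    forall x : rat, q <= ratr x <= r ->
      [\/ p (ratr x) = xi, p (ratr x) = zeta | ~ D (p (ratr x))]].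

Lemma transit_rat xi zeta a b tb : transit xi zeta a b -> clock b < tb ->
  exists q r : rat, rat_transit xi zeta (ratr q) (ratr r) /\ clock (ratr r) < tb.
Proof.
move=> [[dl /andP[d0 da] Hxi] ab Hout pb] cb.
have b0 : 0 <= b by lra.
have [dl2 d20 Hb] := path_right Hp b0.
have [q] : exists q : rat, ratr q \in `]a - dl, a[ by apply: rat_in_itvoo; lra.
rewrite in_itv /= => /andP[q1 q2].
have [r] : exists r : rat, ratr r \in `]b, b + Num.min dl2 (tb - clock b)[.
  by apply: rat_in_itvoo; rewrite ltrDl lt_min d20 subr_gt0.
rewrite in_itv /= => /andP[r1 r2].
have r3 : ratr r < b + dl2 by apply: lt_le_trans r2 _; rewrite lerD2l ge_min lexx.
have r4 : ratr r < b + (tb - clock b).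
  by apply: lt_le_trans r2 _; rewrite lerD2l ge_min lexx orbT.
exists q, r; split; last first.
  have : clock (ratr r) <= clock b + (ratr r - b) by apply: (clock_lip D Hp); rewrite b0 ltW.
  lra.
split.
- by apply/andP; split; lra.
- by apply: Hxi; rewrite q1.
- by rewrite -pb Hb // r3 ltW.
- move=> x /andP[qx xr]; have [xa|ax] := ltP (ratr x) a.
    by apply: Or31; apply: Hxi; apply/andP; split; lra.
  have [xb|bx] := ltP (ratr x) b; first by apply: Or33; apply: Hout; rewrite ax.
  by apply: Or32; rewrite -pb; apply: Hb; rewrite bx; lra.
Qed.

(** Right continuity extends the condition from rational to all times of [q, r]. Then b is the first
    time at zeta, and a is the supremum of the times at xi before b. *)
Lemma rat_transitP xi zeta q r : xi <> zeta -> D xi -> D zeta -> rat_transit xi zeta q r ->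
  exists a b, transit xi zeta a b /\ clock b <= clock r.
Proof.
move=> xz Dxi Dzeta [/andP[q0 qr] pq pr Hx].
have Hs s : q <= s <= r -> [\/ p s = xi, p s = zeta | ~ D (p s)].
  move=> /andP[qs]; rewrite le_eqVlt => /predU1P[->|sr]; first exact: Or32.
  have [dl d0 Hd] := path_right Hp (le_trans q0 qs).
  have [x] : exists x : rat, ratr x \in `]s, Num.min (s + dl) r[.
    by apply: rat_in_itvoo; rewrite lt_min sr andbT ltrDl.
  rewrite in_itv /= lt_min => /andP[sx /andP[xd xr]].
  by rewrite -(Hd (ratr x)) ?xd ?ltW //; apply: Hx; apply/andP; split; lra.
pose Zt := [set t | q <= t <= r /\ p t = zeta].
have Zr : Zt r by split => //; rewrite lexx ltW.
have infZ : has_inf Zt by split; [exists r|exists q => t [/andP[]]].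
pose b := inf Zt.
have lbZ t : Zt t -> b <= t by move=> Zt_; apply: ge_inf => //; case: infZ.
have br : b <= r by exact: lbZ.
have qb : q <= b by apply: lb_le_inf; [exists r|move=> t [/andP[]]].
have pb : p b = zeta.
  have [dl d0 Hd] := path_right Hp (le_trans q0 qb).
  have [t Zt_ tb] := inf_adherent d0 infZ.
  by rewrite -(Hd t) ?lbZ //; case: Zt_.
pose W := [set t | q <= t <= b /\ p t = xi].
have Wq : W q by split => //; rewrite lexx.
have supW : has_sup W by split; [exists q|exists b => t [/andP[]]].
pose a := sup W.
have ubW t : W t -> t <= a by move=> Wt; apply: ub_le_sup => //; case: supW.
have qa : q <= a by exact: ubW.
have ab : a <= b by apply: ge_sup; [exists q|move=> t [/andP[]]].
(* Otherwise the path would stay at xi for a while after a, contradicting the choice of a. *)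
have pa : p a <> xi.
  move=> pa; have [ab'|ba] := ltP a b; last first.
    by apply: xz; rewrite -pa -pb; congr p; lra.
  have [dl d0 Hd] := path_right Hp (le_trans q0 qa).
  pose t := Num.min (a + dl / 2) b.
  have at_ : a < t by rewrite /t lt_min ab' andbT; lra.
  have td : t <= a + dl / 2 by rewrite /t ge_min lexx.
  have tb : t <= b by rewrite /t ge_min lexx orbT.
  have : t <= a by apply: ubW; split; [apply/andP; split; lra|rewrite Hd //; apply/andP; split; lra].
  lra.
have a0 : 0 < a.
  rewrite lt_neqAle (le_trans q0 qa) andbT; apply/eqP => a00.
  by apply: pa; rewrite -pq; congr p; lra.
have [y [dl d0 Hy]] := path_left Hp a0.
have [t Wt ta] := sup_adherent d0 supW.
have yxi : y = xi.
  have ta' : t < a.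
    rewrite lt_neqAle ubW // andbT; apply/eqP => e; apply: pa; rewrite -e.
    by case: Wt.
  by case: Wt => _ <-; rewrite (Hy t) // ta' andbT.
exists a, b; split; last by apply: (clock_le D Hp); rewrite br andbT; lra.
split => //.
  exists (Num.min dl a); first by rewrite lt_min d0 a0 ge_min lexx orbT.
  move=> s /andP[sl sr]; rewrite -yxi; apply: Hy; rewrite sr andbT.
  by apply: le_lt_trans sl; rewrite lerD2l lerN2 ge_min lexx.
move=> s /andP[as_ sb] Ds; have qsr : q <= s <= r by apply/andP; split; lra.
case: (Hs s qsr) => [ps|ps|//].
- have sa : s <= a by apply: ubW; split => //; apply/andP; split; lra.
  by apply: pa; rewrite -ps; congr p; lra.
- have bs : b <= s by apply: lbZ; split => //; apply/andP; split; lra.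
  by move: (lt_le_trans sb bs); rewrite ltxx.
Qed.

End Transit.

(** * The clock as a limit over grids *)

Section Riemann.
Variables (R : realType) (S : Type) (D : set S) (p : R -> S).
Hypothesis Hp : cadlag_path p.
Notation clock := (clock D p).
Notation grid := (grid D p).
Notation mu := (@lebesgue_measure R).

Definition visits h n := (\sum_(j < n) `[< D (p (j%:R * h)) >])%N.

Lemma cell_uniq (h s : R) i j : 0 < h -> cell h i s -> cell h j s -> i = j.
Proof.
move=> h0; rewrite /cell /= !in_itv /= => /andP[i1 i2] /andP[j1 j2].
have : (i < j.+1)%N by rewrite -(ltr_nat R) -(ltr_pM2r h0); lra.
have : (j < i.+1)%N by rewrite -(ltr_nat R) -(ltr_pM2r h0); lra.
lia.
Qed.

Lemma mu_grid h n : 0 < h -> mu (grid h `&` `[0, n%:R * h[) =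
  (h * \sum_(j < n) `[< D (p (j.+1%:R * h)) >]%:R)%:E.
Proof.
move=> h0; elim: n => [|n IH].
  rewrite big_ord0 mulr0 mul0r (_ : _ `&` _ = set0) ?measure0 //.
  by apply/seteqP; split => s //= -[_]; rewrite in_itv /=; lra.
have nh : 0 <= n%:R * h by rewrite mulr_ge0 // ltW.
have cellE : cell h n = `[n%:R * h, n.+1%:R * h[%classic by [].
have nS : n%:R * h < n.+1%:R * h by rewrite ltr_pM2r // ltr_nat.
have -> : grid h `&` `[0, n.+1%:R * h[ =
    (grid h `&` `[0, n%:R * h[) `|` (grid h `&` cell h n).
  rewrite -setIUr cellE; congr (_ `&` _); apply/seteqP; split => s /=; rewrite !in_itv /=.
    by move=> /andP[s0 sn]; case: (ltP s (n%:R * h)) => sa; [left; rewrite s0|right].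
  by move=> [/andP[-> sa]|/andP[sa ->]]; [exact: lt_trans sa nS|rewrite andbT (le_trans nh)].
have mi (A : interval R) : measurable (grid h `&` [set` A]).
  by apply: measurableI; [exact: measurable_grid|exact: measurable_itv].
rewrite measureU; [|exact: mi|exact: mi|]; last first.
  rewrite setIACA setIid cellE; apply/seteqP; split => s //= -[_]; rewrite !in_itv /=.
  by move=> [/andP[_ sa] /andP[as_ _]]; move: (lt_le_trans sa as_); rewrite ltxx.
transitivity (mu (grid h `&` `[0%R, (n%:R * h)%R[) + mu (grid h `&` cell h n))%E; first by [].
rewrite IH big_ord_recr /= mulrDr EFinD; congr (_ + _)%E.
case: asboolP => Dn.
  rewrite mulr1 (_ : _ `&` _ = cell h n); last first.
    by apply/setIidPr => s cs; exists n.
  rewrite cellE lebesgue_measure_itv /= lte_fin nS -EFinB -natr1; congr _%:E; ring.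
rewrite mulr0 (_ : _ `&` _ = set0) ?measure0 //.
apply/seteqP; split => s //= -[[j /= Dj cj] cn].
by move: Dj; rewrite (cell_uniq h0 cj cn).
Qed.

(** Dominated convergence on [0, u]: the indicators converge pointwise by [grid_eventually] and are
    at most 1. *)
Lemma mu_grid_cvg (h : R^nat) u : (forall n, 0 < h n) -> h @ \oo --> (0 : R) ->
  (fun n => mu (grid (h n) `&` `[0, u])) @ \oo --> (clock u)%:E.
Proof.
move=> h0 hcv; rewrite -clockE // trace_clockE //.
have mo := measurable_occupied D Hp.
rewrite -integral_indic //.
under eq_fun do rewrite -(integral_indic mu (measurable_itv _) (measurable_grid D p (h _))).
apply: (@dominated_cvg _ _ _ mu _ _ _ _ (cst 1%E)) => //.
- by move=> n; apply/measurable_EFinP/measurable_indic; exact: measurable_grid.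
- move=> s; rewrite /= in_itv /= => /andP[s0 _].
  apply: (@cvg_trans _ ((fun=> (\1_(occupied D p) s)%:E : \bar R) @ \oo)); last exact: cvg_cst.
  apply: near_eq_cvg; apply: filterS (grid_eventually D Hp h0 hcv s0) => n Hn.
  congr (_%:E); rewrite !indicE; congr (nat_of_bool _)%:R.
  by apply/idP/idP; rewrite !inE => /Hn.
- apply/integrableP; split; first exact: measurable_cst.
  rewrite (eq_integral (cst 1%E)) => [|s _]; last by rewrite /= normr1.
  rewrite integral_cst //= mul1e lebesgue_measure_itv /=.
  by case: ifP => _; rewrite ?ltry.
- move=> n s _; rewrite lee_fin indicE; case: (_ \in _); rewrite /= ?normr1 ?normr0 //.
Qed.

Lemma mu_closed_itv (A : set R) u : measurable A ->
  mu (A `&` `[0, u]) = mu (A `&` `[0, u[).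
Proof.
move=> mA; have mi (B : interval R) : measurable (A `&` [set` B]).
  by apply: measurableI => //; exact: measurable_itv.
apply/eqP; rewrite eq_le; apply/andP; split; last first.
  apply: le_measure; rewrite ?inE //; try exact: mi.
  by apply: setIS => s /=; rewrite !in_itv /= => /andP[-> /ltW].
apply: (@le_trans _ _ (mu ((A `&` `[0, u[) `|` [set u]))).
  apply: le_measure; rewrite ?inE; [exact: mi| |].
    by apply: measurableU; [exact: mi|exact: measurable_set1].
  move=> s /= [As]; rewrite !in_itv /= => /andP[s0].
  by rewrite le_eqVlt => /predU1P[->|su]; [right|left; rewrite s0].
have le2 : (mu ((A `&` `[0%R, u[) `|` [set u]) <= mu (A `&` `[0%R, u[) + mu [set u])%E.
  by apply: measureU2; [exact: mi|exact: measurable_set1].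
apply: le_trans le2 _; by rewrite lebesgue_measure_set1 adde0.
Qed.

(** Exhibits the clock as a limit of functions of finitely many values of the path, which makes it
    measurable in w ([measurable_clock_lt]). *)
Lemma clock_riemann b : 0 < b ->
  (fun n => b / n.+1%:R *
    \sum_(j < n.+1) `[< D (p (j.+1%:R * (b / n.+1%:R))) >]%:R) @ \oo --> clock b.
Proof.
move=> b0; pose h n := b / n.+1%:R.
have h0 n : 0 < h n by rewrite divr_gt0.
have hcv : h @ \oo --> (0 : R).
  by rewrite -(mulr0 b); apply: cvgM; [exact: cvg_cst|exact: cvg_harmonic].
rewrite (_ : (fun n => _) = fine \o (fun n => mu (grid (h n) `&` `[0, b]))).
  exact: fine_cvg (mu_grid_cvg h0 hcv).
apply/funext => n /=; rewrite mu_closed_itv; last exact: measurable_grid.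
have {3}-> : b = n.+1%:R * h n by rewrite /h mulrC divfK.
by rewrite mu_grid.
Qed.

Lemma visits_le h b j : 0 < h -> j%:R * h <= b ->
  h * (visits h j.+1)%:R <= h + fine (mu (grid h `&` `[0, b])).
Proof.
(* [grid] samples right endpoints and so misses time 0, whose visit costs at most h. *)
move=> h0 jb; rewrite /visits big_ord_recl natrD mulrDr; apply: lerD.
  by rewrite ler_piMr ?(ltW h0) // lern1; case: asboolP.
have mi (B : interval R) : measurable (grid h `&` [set` B]).
  by apply: measurableI; [exact: measurable_grid|exact: measurable_itv].
rewrite natr_sum -lee_fin fineK.
  rewrite -mu_grid //; apply: le_measure; rewrite ?inE; try exact: mi.
  by apply: setIS => s /=; rewrite !in_itv /= => /andP[-> sj]; lra.
rewrite ge0_fin_numE //; apply: (@le_lt_trans _ _ (mu `[0, b])).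
  by apply: le_measure; rewrite ?inE; [exact: mi|exact: measurable_itv|exact: subIsetr].
by rewrite lebesgue_measure_itv /=; case: ifP => _; rewrite ?ltry.
Qed.

Lemma grid_index (h a : R) : 0 < h -> 0 < a ->
  exists i : nat, i%:R * h < a <= i.+1%:R * h.
Proof.
move=> h0 a0; have ex : exists n : nat, a <= n%:R * h.
  exists (Num.bound (a / h)); rewrite -ler_pdivrMr // ltW //.
  by apply: archi_boundP; rewrite divr_ge0 // ltW.
case: (ex_minnP ex) => -[|i] an min; first by rewrite mul0r leNgt a0 in an.
by exists i; rewrite an andbT ltNge; apply/negP => /min; rewrite ltnn.
Qed.

(** For a fine mesh, i and j index the last grid times before a and b. Grid times between them fall
    in the excursion, and the one after j falls where the path is still at zeta. An excursion
    without grid times, i = j, is a direct jump of the skeleton. *)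
Lemma transit_skeleton xi zeta a b tb (h : R^nat) (J : nat -> nat) :
  transit D p xi zeta a b -> clock b < tb ->
  (forall n, 0 < h n) -> h @ \oo --> (0 : R) ->
  (forall B : R, \forall n \near \oo, B <= (J n)%:R * h n) ->
  \forall n \near \oo, exists i j : nat,
    [/\ (i <= j < J n)%N, p (i%:R * h n) = xi,
      forall l, (i < l <= j)%N -> ~ D (p (l%:R * h n)), p (j.+1%:R * h n) = zeta &
      h n * (visits (h n) j.+1)%:R < tb].
Proof.
move=> [[dl /andP[d0 da] Hxi] ab Hout pb] cb h0 hcv HJ.
have a0 : 0 < a by lra.
have [dl2 d20 Hb] := path_right Hp (le_trans (ltW a0) ab).
have cvh : (fun n => h n + fine (mu (grid (h n) `&` `[0, b]))) @ \oo --> 0 + clock b.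
  by apply: cvgD => //; exact: fine_cvg (mu_grid_cvg h0 hcv).
near=> n.
have h1 : h n < dl by near: n; exact: (cvgr_lt 0).
have h2 : h n < dl2 by near: n; exact: (cvgr_lt 0).
have h3 : h n + fine (mu (grid (h n) `&` `[0, b])) < tb.
  by near: n; apply: (cvgr_lt _ cvh); rewrite add0r.
have h4 : b + dl2 <= (J n)%:R * h n by near: n.
have [i /andP[i1 i2]] := grid_index (h0 n) a0.
have [j /andP[j1 j2]] := grid_index (h0 n) (lt_le_trans a0 ab).
have hpos := h0 n.
have iS : i.+1%:R * h n = i%:R * h n + h n by rewrite -natr1; ring.
have jS : j.+1%:R * h n = j%:R * h n + h n by rewrite -natr1; ring.
have cmp u v : (u%:R * h n < v%:R * h n) = (u < v)%N by rewrite ltr_pM2r // ltr_nat.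
have cmpe u v : (u%:R * h n <= v%:R * h n) = (u <= v)%N by rewrite ler_pM2r // ler_nat.
exists i, j; split.
- by rewrite -ltnS -cmp -cmp; apply/andP; split; lra.
- by apply: Hxi; rewrite i1 andbT; lra.
- move=> l /andP[il lj]; apply: Hout; rewrite -cmpe in il; rewrite -cmpe in lj.
  by apply/andP; split; lra.
- by rewrite -pb; apply: Hb; rewrite j2 /=; lra.
- by apply: le_lt_trans h3; apply: visits_le => //; lra.
Unshelve. all: by end_near. Qed.

End Riemann.

(** * Probability of a bad jump *)

Section BadEvent.
Variables (R : realType) (S : countType) (St : set S).
Variables (A : (S -> R) -> S -> R) (s0 : S).
Variables (disp : measure_display) (Om : measurableType disp) (P : probability Om R).
Variable X : R -> Om -> S.
Hypothesis HX : is_ctmc St A s0 P X.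
Variables (D : set S) (c : S) (bad : S -> S -> Prop).
Hypothesis Dc : ~ D c.
Notation path w := (fun t => X t w).

(** The strict bound on t leaves room for the error of the discrete clock. *)
Definition bad_before (tb : R) : set Om := [set w | exists t, [/\ 0 < t, t < tb &
  exists xi, [/\ D xi, \forall s \near t^'-, trace_path D c (path w) s = xi,
    D (trace_path D c (path w) t), trace_path D c (path w) t <> xi &
    bad xi (trace_path D c (path w) t)]]].

Definition bad_pair (z : S * S) := [/\ D z.1, D z.2, z.2 <> z.1 & bad z.1 z.2].

Lemma bad_before_transit tb w : bad_before tb w ->
  exists z a b, [/\ bad_pair z, transit D (path w) z.1 z.2 a b & clock D (path w) b < tb].
Proof.
move=> [t [t0 ttb [xi [Dxi near Dz neq bd]]]].
have Hp := ctmc_cadlag HX w.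
have [a [b [tr cb]]] := jump_transit Hp Dc Dxi Dz t0 near erefl.
by exists (xi, trace_path D c (path w) t), a, b; rewrite cb.
Qed.

Lemma transit_bad_before tb w z a b : bad_pair z ->
  transit D (path w) z.1 z.2 a b -> clock D (path w) b < tb -> bad_before tb w.
Proof.
move=> [D1 D2 neq bd] tr cb; have Hp := ctmc_cadlag HX w.
have [t0 near e] := transit_jump Hp c D1 D2 tr.
by exists (clock D (path w) b); split => //; exists z.1; rewrite e.
Qed.

(** Writes the event as a countable union, which is what makes it measurable. *)
Lemma bad_beforeE tb : bad_before tb =
  \bigcup_(i : (S * S) * (rat * rat)) [set w | [/\ bad_pair i.1,
    rat_transit D (path w) i.1.1 i.1.2 (ratr i.2.1) (ratr i.2.2) &
    clock D (path w) (ratr i.2.2) < tb]].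
Proof.
apply/seteqP; split => w.
  move=> /bad_before_transit[z [a [b [bz tr cb]]]].
  have [q [r [rt cr]]] := transit_rat (ctmc_cadlag HX w) tr cb.
  by exists (z, (q, r)).
move=> [[z [q r]] _ /= [bz rt cr]].
have [D1 D2 neq _] := bz.
have [a [b [tr cb]]] := rat_transitP (ctmc_cadlag HX w) (nesym neq) D1 D2 rt.
by apply: (transit_bad_before bz tr); apply: le_lt_trans cr.
Qed.

Lemma measurable_at (t : R) (Q : set S) : 0 <= t -> measurable [set w | Q (X t w)].
Proof.
move=> t0; have -> : [set w | Q (X t w)] = \bigcup_s [set w | Q s /\ X t w = s].
  by apply/seteqP; split => [w Qw|w [s _ [Qs /= ->]]] //; exists (X t w).
apply: countable_bigcupT_measurable => // s.
have [Qs|Qs] := pselect (Q s).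
  rewrite (_ : [set w | _] = [set w | X t w = s]); first exact: (ctmc_measurable HX).
  by apply/seteqP; split => w //= -[].
by rewrite (_ : [set w | _] = set0) //; apply/seteqP; split => w //= -[].
Qed.

Lemma measurable_clock_lt (b tb : R) : 0 < b -> measurable [set w | clock D (path w) b < tb].
Proof.
move=> b0; pose F n w := b / n.+1%:R *
    \sum_(j < n.+1) `[< D (X (j.+1%:R * (b / n.+1%:R)) w) >]%:R.
have mF : measurable_fun setT (fun w => clock D (path w) b).
  apply: (@measurable_fun_cvg _ _ _ _ F); last first.
    by move=> w _; exact: (clock_riemann (ctmc_cadlag HX w) b0).
  move=> n; apply: measurable_funM; first exact: measurable_cst.
  apply: measurable_sum => j.
  have m : measurable [set w | D (X (j.+1%:R * (b / n.+1%:R)) w)].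
    by apply: measurable_at; rewrite mulr_ge0 // divr_ge0 // ltW.
  rewrite (_ : (fun w => _) = \1_[set w | D (X (j.+1%:R * (b / n.+1%:R)) w)]).
    exact: measurable_indic.
  by apply/funext => w; rewrite indicE.
have -> : [set w | clock D (path w) b < tb] =
    setT `&` (fun w => clock D (path w) b) @^-1` `]-oo, tb[.
  by rewrite setTI; apply/seteqP; split => w /=; rewrite in_itv.
exact: mF.
Qed.

Lemma measurable_bad_before tb : measurable (bad_before tb).
Proof.
rewrite bad_beforeE; apply: countable_bigcupT_measurable => // -[z [q r]] /=.
have [bz|bz] := pselect (bad_pair z); last first.
  by rewrite (_ : [set w | _] = set0) //; apply/seteqP; split => w //= -[].
have [/andP[q0 qr]|nqr] := boolP (0 <= (ratr q : R) < ratr r); last first.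
  rewrite (_ : [set w | _] = set0) //; apply/seteqP; split => w //= -[_ [qr]].
  by rewrite qr in nqr.
have r0 : 0 < (ratr r : R) by exact: le_lt_trans qr.
rewrite (_ : [set w | _] = [set w | X (ratr q) w = z.1] `&` [set w | X (ratr r) w = z.2] `&`
   \bigcap_(x in [set x : rat | ratr q <= (ratr x : R) <= ratr r])
     [set w | [\/ X (ratr x) w = z.1, X (ratr x) w = z.2 | ~ D (X (ratr x) w)]] `&`
   [set w | clock D (path w) (ratr r) < tb]); last first.
  apply/seteqP; split => w /=.
    by move=> [_ [_ e1 e2 H] cr]; split => //; split.
  by move=> [[[e1 e2] H] cr]; split => //; split => //; rewrite q0 qr.
apply: measurableI; last exact: measurable_clock_lt.
apply: measurableI.
  by apply: measurableI; apply: (ctmc_measurable HX) => //; exact: ltW.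
rewrite -[\bigcap_(_ in _) _]setCK; apply: measurableC; rewrite setC_bigcap.
rewrite (_ : \bigcup_(_ in _) _ = \bigcup_(x : rat) [set w |
    ratr q <= (ratr x : R) <= ratr r /\
    ~ [\/ X (ratr x) w = z.1, X (ratr x) w = z.2 | ~ D (X (ratr x) w)]]); last first.
  by apply/seteqP; split => w [x]; [exists x|move=> _ []; exists x].
apply: bigcupT_measurable_rat => x.
have [qxr|nqxr] := boolP (ratr q <= (ratr x : R) <= ratr r); last first.
  by rewrite (_ : [set w | _] = set0) //; apply/seteqP; split => w //= -[].
rewrite (_ : [set w | _] =
    [set w | [set s | ~ [\/ s = z.1, s = z.2 | ~ D s]] (X (ratr x) w)]); last first.
  by apply/seteqP; split => w //= -[].
by apply: measurable_at; case/andP: qxr => + _; exact: le_trans.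
Qed.

Variables (e : seq S) (f : S -> S -> R) (eps Cst : R).
Hypotheses (Ue : uniq e) (Ste : forall s, St s <-> s \in e) (s0e : s0 \in e) (Ds0 : D s0).
Hypotheses (eps0 : 0 <= eps) (Cst0 : 0 <= Cst).
Hypothesis Q1 : forall h s, 0 <= h -> s \in e -> \sum_(u <- e) transition A h s u = 1.
Hypothesis f_ge0 : forall m s, 0 <= f m s.
Hypothesis f_refl : forall m, m \in e -> D m -> f m m = 0.
Hypothesis f_bad : forall m s, m \in e -> s \in e -> bad_pair (m, s) -> 1 <= f m s.
Hypothesis f_step : forall h m s, 0 < h <= 1 -> m \in e -> D m -> s \in e -> (D s -> s = m) ->
  \sum_(u <- e) transition A h s u * f m u <= f m s + eps * h * `[< D s >]%:R + Cst * h ^+ 2.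

Lemma prob_bad_before tb : 0 <= tb -> (P (bad_before tb) <= (eps * tb)%:E)%E.
Proof.
move=> tb0.
(* The horizon [J n * h n] tends to infinity, the error [J n * h n ^+ 2] to 0. *)
pose h n : R := n.+1%:R^-1 ^+ 2; pose J n := (n.+1 ^ 3)%N.
have h0 n : 0 < h n by rewrite exprn_gt0 // invr_gt0.
have h1 n : h n <= 1.
  by rewrite exprn_ile1 // ?invr_ge0 // invf_le1 // ler1n.
have Jh n : (J n)%:R * h n = n.+1%:R.
  rewrite /J /h natrX exprVn -[3%N]/(1 + 2)%N exprD expr1 mulfK // expf_neq0 //.
have hcv : h @ \oo --> (0 : R).
  rewrite -(mulr0 0); apply: cvgM; exact: cvg_harmonic.
have JB (B : R) : \forall n \near \oo, B <= (J n)%:R * h n.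
  exists (Num.bound B) => // n /= Bn; rewrite Jh.
  have [B0|B0] := ltP B 0; first by apply: le_trans (ltW B0) _.
  apply: le_trans (ltW (archi_boundP B0)) _.
  by rewrite ler_nat; apply: leq_trans Bn _.
pose Db s := `[< D s >]; pose bb m s := `[< bad_pair (m, s) >].
pose B n := skeleton_bad e s0 X (h n) Db bb tb (J n).
have mB n : measurable (B n) by exact: (measurable_skeleton_bad e HX (ltW (h0 n))).
have PB n : (P (B n) <= (Cst / n.+1%:R + eps * tb)%:E)%E.
  have -> : Cst / n.+1%:R = (J n)%:R * (Cst * h n ^+ 2).
    have -> : (J n)%:R * (Cst * h n ^+ 2) = Cst * ((J n)%:R * h n) * h n by ring.
    rewrite Jh /h; have : n.+1%:R != 0 :> R by rewrite pnatr_eq0.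
    by move: n.+1%:R => x x0; field.
  apply: (prob_skeleton_bad HX Ste (ltW (h0 n)) (f := f)) => //.
  - exact/asboolP.
  - by rewrite mulr_ge0 // exprn_ge0 // ltW.
  - by move=> s; apply: Q1; exact: ltW.
  - by move=> m me /asboolP; exact: f_refl.
  - by move=> m s me _ se _ /asboolP; exact: f_bad.
  - by move=> m; apply/asboolP => -[].
  - move=> m s me /asboolP Dm se Ds; apply: f_step => //; first by rewrite h0 h1.
    by move=> /asboolP.
have Cw w : bad_before tb w -> \forall n \near \oo, B n w.
  move=> /bad_before_transit[z [a [b [bz tr cb]]]]; have Hp := ctmc_cadlag HX w.
  have [D1 D2 _ _] := bz.
  have := transit_skeleton Hp tr cb h0 hcv JB.
  apply: filterS => n [i [j [/andP[ij jJ] pi out pj vis]]].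
  apply: (skeleton_bad_traj HX Ste (ltW (h0 n))).
  apply: (badp_traj (i := j)) => //; first by rewrite pj; apply/asboolP.
  rewrite (@memory_traj _ _ _ _ i) ?pi ?pj //; first by apply/asboolP; case: z bz {tr cb D1 D2 pi pj}.
  - exact/asboolP.
  - by move=> l il; apply/asboolP; exact: out.
(* The events [B n] need not be monotone, so a Fatou argument is used: the bad event is the
   increasing union of the [F m], and each [F m] is contained in [B n] for all n >= m. *)
pose F m := bad_before tb `&` \bigcap_(n in [set n | (m <= n)%N]) B n.
have mF m : measurable (F m).
  apply: measurableI; first exact: measurable_bad_before.
  by apply: bigcap_measurableType => n _; exact: mB.
have FU : bad_before tb = \bigcup_m F m.
  apply/seteqP; split => [w Cw0|w [m _ []]] //.
  by have [m _ Hm] := Cw w Cw0; exists m => //; split => // n mn; exact: Hm.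
have PF m : (P (F m) <= (eps * tb)%:E)%E.
  apply/lee_addgt0Pr => ep ep0; near \oo => n.
  apply: (@le_trans _ _ (P (B n))).
    apply: le_measure; rewrite ?inE; [exact: mF|exact: mB|].
    by move=> w [_]; apply => /=; near: n; exists m.
  apply: le_trans (PB n) _; rewrite -EFinD lee_fin addrC lerD2l ltW //.
  near: n; apply: (cvgr_lt 0) => //.
  by rewrite -(mulr0 Cst); apply: cvgM; [exact: cvg_cst|exact: cvg_harmonic].
have cv : (P \o F) @ \oo --> P (bad_before tb).
  rewrite FU; apply: nondecreasing_cvg_mu => //.
    by rewrite -FU; exact: measurable_bad_before.
  move=> m m' mm'; apply/subsetPset => w [Cw0 H]; split => // n /= m'n.
  by apply: H => /=; exact: leq_trans m'n.
rewrite -(cvg_lim _ cv) //; apply: lime_le; first by apply/cvg_ex; exists (P (bad_before tb)).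
by near=> m; exact: PF.
Unshelve. all: by end_near. Qed.

End BadEvent.

(** * The inclusion process *)

Section Inclusion.
Variables (R : realType) (N L : nat) (d theta : R).
Hypotheses (d0 : 0 <= d) (theta0 : 0 <= theta).
Notation A := (@incl_generator R L d theta).
Implicit Types (f g : config L -> R) (y : config L).

(** The type of configurations is infinite; mass N bounds all values, which allows an enumeration
    through functions into a finite type. *)
Definition omega_seq : seq (config L) :=
  [seq y : config L <- [seq [ffun x => val (g x)] | g : {ffun 'I_L -> 'I_N.+1}] |
    (\sum_x y x == N)%N].

Lemma omega_seq_uniq : uniq omega_seq.
Proof.
rewrite filter_uniq // map_inj_uniq ?enum_uniq // => g1 g2 /ffunP e.
by apply/ffunP => x; apply: val_inj; have := e x; rewrite !ffunE.
Qed.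

Lemma mem_omega_seq y : @Omega N L y <-> y \in omega_seq.
Proof.
rewrite mem_filter /Omega /=; split=> [e|/andP[/eqP]//]; rewrite e eqxx /=.
have ylt x : (y x < N.+1)%N by rewrite ltnS -e (bigD1 x) //= leq_addr.
apply/mapP; exists [ffun x => Ordinal (ylt x)]; first by rewrite mem_enum.
by apply/ffunP => x; rewrite !ffunE.
Qed.

Lemma sum_move y x w : (0 < y x)%N -> (\sum_z move y x w z = \sum_z y z)%N.
Proof.
move=> yx.
have e : (\sum_z (move y x w z + (z == x)) = \sum_z (y z + (z == w)))%N.
  by apply: eq_bigr => z _; rewrite ffunE; case: (eqVneq z x) => [->|_]; lia.
have one v : (\sum_(z : 'I_L) (z == v) = 1)%N.
  by rewrite (bigD1 v) //= eqxx big1 // => i /negbTE ->.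
by move: e; rewrite !big_split /= !one; lia.
Qed.

Lemma generator_sum (I : Type) (r : seq I) (c : I -> R) (f : I -> config L -> R) :
  A (fun u => \sum_(i <- r) c i * f i u) = (fun u => \sum_(i <- r) c i * A (f i) u).
Proof.
apply/funext => u; rewrite /incl_generator.
under [RHS]eq_bigr do rewrite mulr_sumr.
rewrite exchange_big /=; apply: eq_bigr => x _.
under [RHS]eq_bigr do rewrite mulr_sumr.
rewrite exchange_big /=; apply: eq_bigr => w _.
rewrite -sumrB mulr_sumr; apply: eq_bigr => i _; ring.
Qed.

Lemma generator_local f g : {in omega_seq, f =1 g} -> {in omega_seq, A f =1 A g}.
Proof.
move=> fg u ue; have su := (mem_omega_seq u).2 ue.
apply: eq_bigr => x _; apply: eq_bigr => w _.
have [->|ux] := posnP (u x); first by rewrite mulr0 !mul0r.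
by rewrite !fg //; apply/mem_omega_seq; rewrite /Omega /= sum_move.
Qed.

(** Deliberately crude, a sum over all pairs of sites: it enters only the error of order h^2, which
    vanishes for fixed N. *)
Definition rate_bound : R := 2 * L%:R ^+ 2 * theta * N%:R * (d + N%:R).

Lemma generator_bound f B : 0 <= B -> {in omega_seq, forall u, `|f u| <= B} ->
  {in omega_seq, forall u, `|A f u| <= rate_bound * B}.
Proof.
move=> B0 fB u ue; have su := (mem_omega_seq u).2 ue.
have uN x : (u x)%:R <= N%:R :> R.
  by rewrite ler_nat -[leqRHS]su (bigD1 x) //= leq_addr.
have term x w : `|theta * (u x)%:R * (d + (u w)%:R) * (f (move u x w) - f u)| <=
    theta * N%:R * (d + N%:R) * (2 * B).
  have [->|ux] := posnP (u x).
    rewrite mulr0 !mul0r normr0 !mulr_ge0 //; exact: addr_ge0.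
  have r0 : 0 <= theta * (u x)%:R * (d + (u w)%:R).
    by rewrite !mulr_ge0 // addr_ge0.
  rewrite normrM (ger0_norm r0); apply: ler_pM => //.
    apply: ler_pM; rewrite ?mulr_ge0 ?addr_ge0 //; last by rewrite lerD2l.
    by rewrite ler_wpM2l.
  apply: le_trans (ler_normB _ _) _; rewrite mulr_natl mulr2n lerD ?fB //.
  by apply/mem_omega_seq; rewrite /Omega /= sum_move.
set b := theta * N%:R * (d + N%:R) * (2 * B) in term.
have b0 : 0 <= b by rewrite /b !mulr_ge0 // addr_ge0.
apply: le_trans (ler_norm_sum _ _ _) _.
apply: (@le_trans _ _ (\sum_(x : 'I_L) \sum_(w : 'I_L) b)).
  apply: ler_sum => x _; apply: le_trans (ler_norm_sum _ _ _) _.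
  rewrite big_mkcond /=; apply: ler_sum => w _.
  by case: ifP => _; [exact: term|exact: b0].
rewrite !sumr_const card_ord -mulrnA -mulr_natl natrM /rate_bound /b le_eqVlt.
by apply/orP; left; apply/eqP; ring.
Qed.

Lemma generator_1 : A (fun=> 1) = fun=> 0.
Proof.
apply/funext => u; rewrite /incl_generator big1 // => x _.
by rewrite big1 // => w _; rewrite subrr mulr0.
Qed.

Lemma rate_bound_ge0 : 0 <= rate_bound.
Proof. by rewrite /rate_bound !mulr_ge0 ?addr_ge0 ?exprn_ge0. Qed.

Lemma transition_total h s : 0 <= h -> s \in omega_seq ->
  \sum_(u <- omega_seq) transition A h s u = 1.
Proof.
move=> h0 se; transitivity (semigroup A h (fun=> 1) s); last first.
  exact: (semigroup1 generator_sum generator_1).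
rewrite -(transition_sum rate_bound_ge0 generator_sum generator_local generator_bound
  (fun=> 1) omega_seq_uniq h0 se).
by apply: eq_bigr => u _; rewrite mulr1.
Qed.

Lemma transition_step h g s : 0 <= h <= 1 -> (forall u, 0 <= g u <= 1) -> s \in omega_seq ->
  \sum_(u <- omega_seq) transition A h s u * g u <=
  g s + h * A g s + rate_bound ^+ 2 * expR rate_bound * h ^+ 2.
Proof.
move=> /andP[h0 h1] g1 se; have K0 := rate_bound_ge0.
rewrite (transition_sum K0 generator_sum generator_local generator_bound
  g omega_seq_uniq h0 se).
have gb : {in omega_seq, forall u, `|g u| <= 1}.
  by move=> u _; have /andP[a b] := g1 u; rewrite ger0_norm.
have := semigroup_expansion K0 generator_bound h0 ler01 se gb.
rewrite ler_distl => /andP[_ /le_trans]; apply; rewrite lerD2l mul1r exprMn mulrAC.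
apply: ler_wpM2r; first exact: exprn_ge0.
apply: ler_wpM2l; first exact: exprn_ge0.
by rewrite ler_expR ler_piMr.
Qed.

End Inclusion.

(** The induction step is ln (1 - x) <= - x at x = 1 / (n + 2). *)
Lemma harm_ln (R : realType) n : harm R n.+1 <= 1 + ln n.+1%:R.
Proof.
elim: n => [|n IH]; first by rewrite harmS harm0 invr1 ln1; lra.
rewrite harmS; apply: le_trans (lerD IH (lexx _)) _.
have n0 : 0 < n.+1%:R :> R by [].
have n1 : 0 < n.+2%:R :> R by [].
rewrite -addrA lerD2l.
have -> : n.+1%:R = n.+2%:R * (1 - n.+2%:R^-1) :> R.
  by rewrite mulrBr mulr1 divff ?gt_eqF // -[n.+2%:R]natr1 addrK.
have i1 : (n.+2%:R^-1 : R) < 1 by rewrite invf_lt1 // ltr1n.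
rewrite lnM ?posrE //; last by rewrite subr_gt0.
have : ln (1 - n.+2%:R^-1) <= - n.+2%:R^-1 :> R by apply: le_ln1Dx; rewrite ltrN2.
by move=> H; rewrite -addrA gerDl -lerBrDr sub0r.
Qed.

(** * From the bad event to the time tau *)

Section TraceBound.
Variables (R : realType) (k N L : nat) (d : R).
Hypotheses (L5 : (5 <= L)%N) (N0 : (0 < N)%N) (d0 : 0 < d).
Variables (xi : config L) (disp : measure_display) (Om : measurableType disp).
Variables (P : probability Om R) (X : R -> Om -> config L).
Hypothesis Exi : E k N xi.
Let theta : R := N%:R ^+ 2 / d.
Hypothesis HX : is_ctmc (@Omega N L) (@incl_generator R L d theta) xi P X.

Let L1 : (1 < L)%N. Proof. exact: leq_trans L5. Qed.

Let theta0 : 0 <= theta.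
Proof. by rewrite divr_ge0 ?exprn_ge0 // ltW. Qed.

Lemma E_sparseP (y : config L) : E k N y <-> sparse k N y.
Proof. by split; [exact: E_sparse|exact: sparse_E]. Qed.

Lemma sparse_empty : ~ E k N (@empty_config L).
Proof.
by move=> /E_sparseP[e _ _]; move: N0; rewrite -e big1 // => x _; rewrite ffunE.
Qed.

Definition rate : R := 8 * k%:R * N%:R ^+ 3 * d * harm R N.

Notation bad_before :=
  (bad_before X (@E k N L) (@empty_config L) (fun m y => ~ neighbors k N m y)).

Lemma prob_bad tb : 0 <= tb -> (P (bad_before tb) <= (rate * tb)%:E)%E.
Proof.
have rate0 : 0 <= rate by rewrite !mulr_ge0 ?harm_ge0 ?exprn_ge0 // ltW.
have K0 := rate_bound_ge0 N L (ltW d0) theta0.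
apply: (prob_bad_before HX sparse_empty (e := omega_seq N L) (f := pot N d)
  (Cst := rate_bound N L d theta ^+ 2 * expR (rate_bound N L d theta))) => //.
- exact: omega_seq_uniq.
- exact: mem_omega_seq.
- by apply/mem_omega_seq; have [] := (E_sparseP xi).1 Exi.
- by rewrite mulr_ge0 ?exprn_ge0 // expR_ge0.
- by move=> h s h0 se; apply: (transition_total (N := N) (ltW d0) theta0).
- by move=> m s; apply: pot_ge0.
- by move=> m _ /E_sparseP sm; apply: (pot_refl L5 d0 N0 sm).
- move=> m s _ _ [/E_sparseP sm /E_sparseP ss neq nb]; rewrite (pot_far d L5 sm ss neq nb) //.
- move=> h m s /andP[h0 h1] _ /E_sparseP sm se sE.
  have h01 : 0 <= h <= 1 by rewrite ltW.
  have p01 u : 0 <= pot N d m u <= 1 by rewrite pot_ge0 // pot_le1.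
  apply: le_trans (transition_step (ltW d0) theta0 h01 p01 se) _.
  rewrite lerD2r lerD2l (mulrC rate) -mulrA; apply: ler_wpM2l; first exact: ltW.
  case: asboolP => sEs; last first.
    rewrite mulr0; apply: (@generator_pot_le0 _ k) => //; first by apply/mem_omega_seq.
    by move=> /E_sparseP.
  by rewrite mulr1 (sE sEs); exact: generator_pot_refl.
Qed.

(** The infimum in [tau] is not assumed to be attained, so the event is approached through slightly
    later times. *)
Lemma tau_before (T : R) : [set w | (tau k N (trace_path (@E k N L) (empty_config L)
    (fun t => X t w)) <= T%:E)%E] = \bigcap_n bad_before (T + n.+1%:R^-1).
Proof.
apply/seteqP; split => w /=.
  move=> tauT n _.
  have : (tau k N (trace_path (@E k N L) (empty_config L) (fun t => X t w)) <
      (T + n.+1%:R^-1)%:E)%E.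
    by apply: le_lt_trans tauT _; rewrite lte_fin ltrDl invr_gt0.
  move=> /ereal_inf_lt[_ [t [t0 [m [Em near Et neq nb]]] <-]]; rewrite lte_fin => tT.
  by exists t; split => //; exists m.
move=> H; apply/lee_addgt0Pr => ep ep0.
have [n _ /(_ n (leqnn n)) nep] : \forall n \near \oo, (harmonic n : R) < ep.
  exact: (cvgr_lt 0 cvg_harmonic).
have [t [t0 tT [m [Em near Et neq nb]]]] := H n I.
apply: (@le_trans _ _ t%:E); first by apply: ereal_inf_lbound; exists t => //; split => //; exists m.
by rewrite -EFinD lee_fin ltW // (lt_trans tT) // ltrD2l.
Qed.

Lemma trace_law_tau_le (T : R) : 0 <= T ->
  (trace_law k N P X [set p | (tau k N p <= T%:E)%E] <= (rate * (T + 1))%:E)%E.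
Proof.
move=> T0; rewrite /trace_law /= tau_before.
have T1 : 0 <= T + 1 by lra.
have mB tb : measurable (bad_before tb) by exact: (measurable_bad_before HX _ sparse_empty).
apply: le_trans (prob_bad T1); apply: le_measure; rewrite ?inE //.
  by apply: bigcap_measurableType => n _; exact: mB.
(* The member n = 0 of the intersection, with time bound T + 1, is enough. *)
by move=> w /(_ 0%N I); rewrite invr1.
Qed.

End TraceBound.

(** Serves the lower bound of the squeeze: the supremum over an empty set would be minus
    infinity. *)
Lemma E_nonempty k N L : (0 < k)%N -> (0 < N)%N -> (0 < L)%N -> exists xi, @E k N L xi.
Proof.
move=> k0 N0 L0; pose x0 := Ordinal L0.
exists (xi_conf (fun _ : 'I_1 => x0) (fun _ => N)), 1%N; split => //.
exists (fun _ => x0), (fun _ => N); split => //; split => //.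
- by move=> o i j _; rewrite !ord1.
- by move=> i j; left.
- by rewrite big_ord1.
Qed.

Theorem theorem1p6 (R : realType) (k : nat) (hk : (1 <= k)%N)
  (rho : R) (hrho : 0 < rho)
  (L : nat -> nat) (hL : forall N, (0 < L N)%N)
  (hLoo : L @ \oo --> \oo)
  (hNL : (fun N => N%:R / (L N)%:R : R) @ \oo --> rho)
  (d : nat -> R) (hd : forall N, 0 < d N)
  (hdlog : (fun N => d N * N%:R ^+ 3 * ln (N%:R : R)) @ \oo --> (0 : R))
  (disp : forall N : nat, config (L N) -> measure_display)
  (Om : forall (N : nat) (xi : config (L N)), measurableType (disp N xi))
  (P : forall (N : nat) (xi : config (L N)), probability (Om N xi) R)
  (eta : forall (N : nat) (xi : config (L N)),
    R -> Om N xi -> config (L N))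
  (heta : forall (N : nat) (xi : config (L N)), E k N xi ->
    is_ctmc (@Omega N (L N))
      (@incl_generator R (L N) (d N) (N%:R ^+ 2 / d N)) xi
      (P N xi) (eta N xi))
  (T : R) (hT : 0 < T) :
  (fun N => ereal_sup
     [set trace_law k N (P N xi) (eta N xi)
            [set p | (tau k N p <= T%:E)%E] | xi in @E k N (L N)])
    @ \oo --> (0 : \bar R)%E.
Proof.
have ln2 : 0 < ln (2 : R) by rewrite ln_gt0 // ltr1n.
(* For N >= 2 one has 1 <= ln N / ln 2, so [harm_ln] gives [harm N] <= (1 + 1 / ln 2) ln N; the
   other factors come from [rate] and from the time bound T + 1. *)
pose C : R := 8 * k%:R * (1 + (ln 2)^-1) * (T + 1).
pose u N : \bar R := (C * (d N * N%:R ^+ 3 * ln (N%:R : R)))%:E.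
apply: (squeeze_cvge (f := cst 0%E) (h := u)).
- near=> N.
  have N2 : (2 <= N)%N by near: N; exists 2%N.
  have L5 : (5 <= L N)%N.
    by near: N; apply: (hLoo [set n | (5 <= n)%N]); exists 5%N.
  have N0 : (0 < N)%N by exact: leq_trans N2.
  apply/andP; split; rewrite /cst.
    have [xi Exi] := E_nonempty hk N0 (hL N).
    apply: (@le_trans _ _ (trace_law k N (P N xi) (eta N xi) [set p | (tau k N p <= T%:E)%E])).
      by rewrite /trace_law.
    by apply: ereal_sup_ubound; exists xi.
  apply: ge_ereal_sup => _ [xi Exi <-].
  apply: le_trans (trace_law_tau_le L5 N0 (hd N) Exi (heta N xi Exi) (ltW hT)) _.
  rewrite lee_fin /rate /C.
  have lnN : ln 2 <= ln (N%:R : R) by rewrite ler_ln ?posrE ?ltr0n // ler_nat.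
  have hN : harm R N <= (1 + (ln 2)^-1) * ln N%:R.
    have := harm_ln R N.-1; rewrite prednK // => /le_trans; apply.
    rewrite mulrDl mul1r addrC lerD2l mulrC ler_pdivlMr // mul1r //.
  have dN : 0 <= 8 * k%:R * N%:R ^+ 3 * d N * (T + 1).
    by rewrite !mulr_ge0 ?exprn_ge0 //; [exact: ltW|lra].
  have := ler_wpM2l dN hN.
  by rewrite [X in X <= _](_ : _ = 8 * k%:R * N%:R ^+ 3 * d N * harm R N * (T + 1)); [|ring];
    rewrite [X in _ <= X](_ : _ = 8 * k%:R * (1 + (ln 2)^-1) * (T + 1) *
      (d N * N%:R ^+ 3 * ln N%:R)); [|ring].
- exact: cvg_cst.
- apply/fine_cvgP; split; first by near=> N.
  by rewrite -(mulr0 C); apply: cvgM => //; exact: cvg_cst.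
Unshelve. all: by end_near. Qed.
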